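(* Let $\mathfrak{g}_{4|2}^{1}$ and $\mathfrak{g}_{4|2}^{2}(\lambda)$ ($\lambda\in\mathbb{C}$) be the complex Lie superalgebras of dimension $4|2$ with basis $\{e_1,e_2,e_3,e_4\mid e_5,e_6\}$ ($e_1,\dots,e_4$ even, $e_5,e_6$ odd) and nontrivial brackets \begin{align*} \mathfrak{g}_{4|2}^{1}:\ &[e_1,e_2]=e_2,\ [e_1,e_3]=-e_3,\ [e_2,e_3]=e_4,\ [e_1,e_6]=e_5,\ [e_6,e_6]=e_4;\\ \mathfrak{g}_{4|2}^{2}(\lambda):\ &[e_1,e_2]=e_2,\ [e_1,e_3]=-e_3,\ [e_2,e_3]=e_4,\ [e_1,e_5]=\lambda e_5,\ [e_1,e_6]=-\lambda e_6,\ [e_5,e_6]=\lambda e_4. \end{align*} Then $\mathfrak{g}_{4|2}^{1}$ has only one (nontrivial) metric deformation, up to equivalence and change of parameter, and it is a smooth deformation to the family $\mathfrak{g}_{4|2}^{2}(\lambda)$ around $\lambda=0$.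
   Context: All Lie superalgebras are over $\mathbb{C}$. Brackets of basis elements that are not listed are zero or determined by $[y,x]=-(-1)^{|x||y|}[x,y]$. A metric Lie superalgebra is a Lie superalgebra together with an even, non-degenerate, supersymmetric bilinear form $B$ that is invariant: $B([x,y],z)=B(x,[y,z])$. A formal 1-parameter deformation of a Lie superalgebra $(\mathfrak g,[\ ,\ ])$ is a $\mathbb{C}[[t]]$-bilinear Lie superalgebra structure on $\mathfrak g[[t]]=\mathfrak g\otimes_{\mathbb C}\mathbb{C}[[t]]$ of the form $[\ ,\ ]_t=[\ ,\ ]+\sum_{i\ge1}t^i\phi_i$, each $\phi_i:\mathfrak g\times\mathfrak g\to\mathfrak g$ being an even super-skew-symmetric bilinear map. Two such deformations $[\ ,\ ]_t,[\ ,\ ]'_t$ are equivalent if there is $\widehat\psi_t=\mathrm{id}+\psi_1t+\psi_2t^2+\cdots$ with even linear $\psi_i:\mathfrak g\to\mathfrak g$ and $\widehat\psi_t([x,y]_t)=[\widehat\psi_t(x),\widehat\psi_t(y)]'_t$ for all $x,y\in\mathfrak g$. A deformation is trivial if it is equivalent to the original bracket. A metric deformation is a formal 1-parameter deformation that defines a metric Lie superalgebra, i.e. $(\mathfrak g[[t]],[\ ,\ ]_t)$ admits an even, supersymmetric, invariant $\mathbb{C}[[t]]$-bilinear form that is non-degenerate over $\mathbb{C}[[t]]$ (induces an isomorphism with the dual module). A deformation is smooth if for different non-zero values of $t$ near the origin it defines non-isomorphic algebras (coincidences caused by symmetry being allowed). It is a smooth deformation to a family $\mathfrak h(\lambda)$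 around $\lambda_0$ if it is smooth and for non-zero $t$ near the origin it is isomorphic to $\mathfrak h(\lambda(t))$ with $\lambda(t)\to\lambda_0$ as $t\to0$. *)

(* Defs.v *)
From HB Require Import structures.
From mathcomp Require Import all_boot all_order all_algebra all_fingroup.
From mathcomp Require Import all_classical all_reals all_analysis.
From mathcomp Require Import complex.

Set Implicit Arguments.
Unset Strict Implicit.
Unset Printing Implicit Defensive.

Import Order.TTheory GRing.Theory Num.Theory.
Import numFieldNormedType.Exports.

Local Open Scope classical_set_scope.
Local Open Scope ring_scope.

Record fps (K : Type) := Fps { coefs : nat -> K }.

Lemma fpsP (K : Type) (f g : fps K) : coefs f =1 coefs g -> f = g.
Proof. by case: f g => f [g] /= /funext ->. Qed.

HB.instance Definition _ (K : Type) := gen_eqMixin (fps K).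
HB.instance Definition _ (K : Type) := gen_choiceMixin (fps K).

Section FpsRing.
Variable K : comNzRingType.
Implicit Types f g h : fps K.

Definition fpsC (a : K) : fps K := Fps (fun n => if n == 0%N then a else 0).
Definition fps_add f g : fps K := Fps (fun n => coefs f n + coefs g n).
Definition fps_opp f : fps K := Fps (fun n => - coefs f n).
Definition fps_mul f g : fps K :=
  Fps (fun n => \sum_(i < n.+1) coefs f i * coefs g (n - i)%N).

Fact fps_addA : associative fps_add.
Proof. by move=> f g h; apply: fpsP => n /=; rewrite addrA. Qed.
Fact fps_addC : commutative fps_add.
Proof. by move=> f g; apply: fpsP => n /=; rewrite addrC. Qed.
Fact fps_add0 : left_id (fpsC 0) fps_add.
Proof. by move=> f; apply: fpsP => n /=; rewrite if_same add0r. Qed.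
Fact fps_addN : left_inverse (fpsC 0) fps_opp fps_add.
Proof. by move=> f; apply: fpsP => n /=; rewrite if_same addNr. Qed.

HB.instance Definition _ :=
  GRing.isZmodule.Build (fps K) fps_addA fps_addC fps_add0 fps_addN.

Let trunc N f : {poly K} := \poly_(i < N) coefs f i.

Let trunc_mul N f g n : (n < N)%N ->
  coefs (fps_mul f g) n = (trunc N f * trunc N g)`_n.
Proof.
move=> nN; rewrite coefM /=; apply: eq_bigr => i _; rewrite !coef_poly.
have iN : (i < N)%N by apply: leq_trans nN; rewrite ltnS -ltnS ltn_ord.
by rewrite iN (leq_ltn_trans (leq_subr _ _) nN).
Qed.

Fact fps_mulC : commutative fps_mul.
Proof.
by move=> f g; apply: fpsP => n; rewrite !(trunc_mul _ _ (ltnSn n)) mulrC.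
Qed.

Fact fps_mulA : associative fps_mul.
Proof.
move=> f g h; apply: fpsP => n.
transitivity ((trunc n.+1 f * (trunc n.+1 g * trunc n.+1 h))`_n).
  rewrite coefM /=; apply: eq_bigr => i _; rewrite coef_poly ltn_ord.
  by congr (_ * _); apply: (trunc_mul (N := n.+1)); rewrite ltnS leq_subr.
rewrite mulrA coefM /=; apply: eq_bigr => i _.
rewrite [(trunc n.+1 h)`_ _]coef_poly ltnS leq_subr.
by congr (_ * _); apply/esym/(trunc_mul (N := n.+1)).
Qed.

Fact fps_mul1 : left_id (fpsC 1) fps_mul.
Proof.
move=> f; apply: fpsP => n /=; rewrite big_ord_recl /= mul1r subn0.
by rewrite big1 ?addr0 // => i _; rewrite mul0r.
Qed.

Fact fps_mulDl : left_distributive fps_mul fps_add.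
Proof.
move=> f g h; apply: fpsP => n /=; rewrite -big_split /=.
by apply: eq_bigr => i _; rewrite mulrDl.
Qed.

Fact fps_1neq0 : fpsC 1 != 0.
Proof. by apply/eqP => -[/(congr1 (@^~ 0%N))] /= /eqP; rewrite oner_eq0. Qed.

HB.instance Definition _ := GRing.Zmodule_isComNzRing.Build (fps K)
  fps_mulA fps_mulC fps_mul1 fps_mulDl fps_1neq0.

(* f(s(t)); the truncation of the sum is legitimate when s has no constant
   term, the only case in which it is used *)
Definition fps_comp (s f : fps K) : fps K :=
  Fps (fun n => \sum_(k < n.+1) coefs f k * coefs (s ^+ k) n).

End FpsRing.

(* Elements of K^{m|n} are row vectors; the first m basis vectors are even and
   the last n are odd.  For K = C[[t]] this is g[[t]] with g = C^{m|n}. *)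
Section Super.
Variables (K : comNzRingType) (m n : nat).
Local Notation V := 'rV[K]_(m + n).
Implicit Types (br : V -> V -> V) (B : V -> V -> K).

Definition homogeneous (p : bool) (x : V) : Prop :=
  forall i : 'I_(m + n), (m <= i)%N != p -> x 0 i = 0.

Definition even_linear (psi : V -> V) : Prop :=
  linear psi /\ forall p x, homogeneous p x -> homogeneous p (psi x).

Record even_super_skew br : Prop := EvenSuperSkew {
  br_linearl : forall y, linear (br^~ y);
  br_linearr : forall x, linear (br x);
  br_even : forall p q x y, homogeneous p x -> homogeneous q y ->
    homogeneous (p (+) q) (br x y);
  br_skew : forall p q x y, homogeneous p x -> homogeneous q y ->
    br y x = - ((-1) ^+ (p && q) *: br x y) }.

Definition super_jacobi br : Prop :=
  forall p q r x y z,
    homogeneous p x -> homogeneous q y -> homogeneous r z ->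
    br x (br y z) = br (br x y) z + (-1) ^+ (p && q) *: br y (br x z).

Definition lie_superalgebra br : Prop := even_super_skew br /\ super_jacobi br.

Record metric_form br B : Prop := MetricForm {
  form_scalarl : forall y, scalar (B^~ y);
  form_scalarr : forall x, scalar (B x);
  form_even : forall p q x y, homogeneous p x -> homogeneous q y ->
    p != q -> B x y = 0;
  form_supersym : forall p q x y, homogeneous p x -> homogeneous q y ->
    B y x = (-1) ^+ (p && q) * B x y;
  form_invariant : forall x y z, B (br x y) z = B x (br y z);
  form_nondegenerate : forall f : V -> K, scalar f ->
    exists! x, forall y, B x y = f y }.

Definition metric br : Prop :=
  lie_superalgebra br /\ exists B, metric_form br B.

Definition isomorphic br br' : Prop :=
  exists psi : V -> V,
    [/\ even_linear psi, bijective psi &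
        forall x y, psi (br x y) = br' (psi x) (psi y)].

End Super.

(* The bilinear bracket on L^{m|n} whose structure constants are the images
   under f of those of br. *)
Definition base_change (K L : comNzRingType) (m n : nat) (f : K -> L)
    (br : 'rV[K]_(m + n) -> 'rV[K]_(m + n) -> 'rV[K]_(m + n))
    (x y : 'rV[L]_(m + n)) : 'rV[L]_(m + n) :=
  \sum_i \sum_j (x 0 i * y 0 j) *:
    map_mx f (br (delta_mx 0 i) (delta_mx 0 j)).

Section Deformation.
Variables (C : comNzRingType) (m n : nat).
Local Notation V := 'rV[C]_(m + n).
Local Notation Vt := 'rV[fps C]_(m + n).
Implicit Types (br : V -> V -> V) (brt : Vt -> Vt -> Vt).

(* phi_i, where [x, y]_t = \sum_i t^i phi_i(x, y) for x, y in g *)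
Definition deformation_term brt (i : nat) (x y : V) : V :=
  map_mx (fun f : fps C => coefs f i)
    (brt (map_mx (@fpsC C) x) (map_mx (@fpsC C) y)).

Definition deformation br brt : Prop :=
  [/\ lie_superalgebra brt,
      forall x y, deformation_term brt 0 x y = br x y &
      forall i, (0 < i)%N -> even_super_skew (deformation_term brt i)].

Definition metric_deformation br brt : Prop :=
  deformation br brt /\ metric brt.

Definition equivalent brt brt' : Prop :=
  exists psi : Vt -> Vt,
    [/\ even_linear psi,
        forall x : V,
          map_mx (fun f => coefs f 0) (psi (map_mx (@fpsC C) x)) = x &
        forall x y, psi (brt x y) = brt' (psi x) (psi y)].

Definition trivial_deformation br brt : Prop :=
  equivalent brt (base_change (@fpsC C) br).

(* t |-> s(t) need not be invertible, e.g. s(t) = t ^ 2. *)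
Definition parameter_change (s : fps C) : Prop := coefs s 0 = 0 /\ s <> 0.

Definition reparametrize (s : fps C) brt : Vt -> Vt -> Vt :=
  base_change (fps_comp s) brt.

End Deformation.

Section Smooth.
Variables (C : numClosedFieldType) (m n : nat).
Local Notation V := 'rV[C]_(m + n).
Local Notation Vt := 'rV[fps C]_(m + n).
Implicit Types (br : V -> V -> V) (brt : Vt -> Vt -> Vt).

Definition fps_series (t : C) (f : fps C) : C^nat :=
  [series coefs f k * t ^+ k]_k.

Definition fps_eval (t : C) (f : fps C) : C := limn (fps_series t f).

Definition converges_at brt (t : C) : Prop :=
  forall i j k,
    cvgn (fps_series t (brt (delta_mx 0 i) (delta_mx 0 j) 0 k)).

Definition specialize brt (t : C) : V -> V -> V := base_change (fps_eval t) brt.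

(* Coincidences are allowed only along the orbits of a finite group acting
   holomorphically on a neighbourhood U of the origin and fixing the origin. *)
Definition smooth_deformation brt : Prop :=
  exists U : set C,
    [/\ open U, U 0, forall t, U t -> converges_at brt t &
      exists (G : finGroupType) (sigma : {action G &-> C}),
        [/\ forall g, sigma 0 g = 0,
            forall g t, U t -> U (sigma t g),
            forall g t, U t -> derivable (sigma^~ g) t 1 &
            forall t t', U t -> U t' -> t != 0 -> t' != 0 ->
              isomorphic (specialize brt t) (specialize brt t') <->
              exists g, t' = sigma t g]].

Definition smooth_deformation_to brt (h : C -> V -> V -> V) (lambda0 : C) :
    Prop :=
  smooth_deformation brt /\
  exists lambda : C -> C,
    lambda t @[t --> 0^'] --> lambda0 /\
    \forall t \near 0^', isomorphic (specialize brt t) (h (lambda t)).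

End Smooth.

Section Algebras.
Variable C : comNzRingType.
Local Notation V := 'rV[C]_(4 + 2).

(* 1-based: e 1, ..., e 4 are even, e 5 and e 6 are odd *)
Definition e (k : nat) : V := \row_(i < 4 + 2) (i.+1 == k)%:R.

(* T k l lists [e k, e l] for k <= l; the other brackets follow from
   super-skew-symmetry, (-1) ^+ _ being the sign of two odd elements *)
Definition bracket_of (T : nat -> nat -> V) (x y : V) : V :=
  \sum_(i < 4 + 2) \sum_(j < 4 + 2) (x 0 i * y 0 j) *:
    (if (i <= j)%N then T i.+1 j.+1
     else - ((-1) ^+ ((4 <= i)%N && (4 <= j)%N) *: T j.+1 i.+1)).

Definition g42_1 : V -> V -> V := bracket_of (fun k l =>
  match k, l with
  | 1, 2 => e 2
  | 1, 3 => - e 3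
  | 2, 3 => e 4
  | 1, 6 => e 5
  | 6, 6 => e 4
  | _, _ => 0
  end).

Definition g42_2 (lambda : C) : V -> V -> V := bracket_of (fun k l =>
  match k, l with
  | 1, 2 => e 2
  | 1, 3 => - e 3
  | 2, 3 => e 4
  | 1, 5 => lambda *: e 5
  | 1, 6 => - lambda *: e 6
  | 5, 6 => lambda *: e 4
  | _, _ => 0
  end).

End Algebras.

(* Main.v *)
Require Import Defs.
From HB Require Import structures.
From mathcomp Require Import all_boot all_order all_algebra all_fingroup.
From mathcomp Require Import all_classical all_reals all_analysis.
From mathcomp Require Import complex ring.

Set Implicit Arguments.
Unset Strict Implicit.
Unset Printing Implicit Defensive.

Import Order.TTheory GRing.Theory Num.Theory.
Import numFieldNormedType.Exports.

Local Open Scope classical_set_scope.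
Local Open Scope ring_scope.

(* A metric deformation br of g42_1 is brought to the normal form fam s by
   choosing a frame of g[[t]] step by step.  Start from f1 = e1, f6 = e6,
   f5 = [f1, f6], f4 = [f6, f6].  Invariance of the form gives [f1, f5] = s f6,
   and r = [f5, f6] satisfies [f1, [f1, r]] = 4 s r and B(r, f1) = B(r, f4) = 0;
   these equations have no nonzero solution modulo t, so r vanishes t-adically.
   Invariance then lets one correct e2 and e3 by multiples of f1 so that they
   commute with f4, f5, f6, and the Jacobi identity makes ad f1 traceless on
   their span modulo f4; diagonalizing it (its eigenvalues are +- m with m = 1
   modulo t) and rescaling yields fam (s / m ^ 2).  All fam s are pulled back
   from fam X along t |-> s(t), and s = 0 is the trivial deformation.  Finally
   fam t is determined by t, because ad e1 squares to the identity on e2 and e3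
   and to t on the odd part, and fam t is g42_2 lambda with lambda ^ 2 = t. *)

(** Course-of-values recursion: since [F n] only looks below [n], iterating from the constant
    sequence [d] freezes the entry [n] after [n.+1] rounds. It constructs power series coefficient
    by coefficient. *)
Lemma causal_fixpoint (T : Type) (d : T) (F : nat -> (nat -> T) -> T) :
    (forall n u v, (forall i, (i < n)%N -> u i = v i) -> F n u = F n v) ->
  exists g, forall n, g n = F n g.
Proof.
move=> causal; pose h k := iter k (fun u n => F n u) (fun=> d).
have stable n : forall k l, (n < k)%N -> (n < l)%N -> h k n = h l n.
  elim/ltn_ind: n => n IHn [|k] [|l] // nk nl.
  by apply: causal => i lt_in; apply: IHn => //; exact: leq_trans lt_in _.
exists (fun n => h n.+1 n) => n; apply: causal => i lt_in.
exact: stable.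
Qed.

(** * Formal power series: coefficients, constants and substitution *)

Section FpsRing.
Variable K : comNzRingType.
Implicit Types f g : fps K.

Lemma coefsD f g n : coefs (f + g) n = coefs f n + coefs g n.
Proof. by []. Qed.

Lemma coefsN f n : coefs (- f) n = - coefs f n.
Proof. by []. Qed.

Lemma coefs0 n : coefs (0 : fps K) n = 0.
Proof. by rewrite /= if_same. Qed.

Lemma coefsM f g n :
  coefs (f * g) n = \sum_(i < n.+1) coefs f i * coefs g (n - i)%N.
Proof. by []. Qed.

Lemma coefsM0 f g : coefs (f * g) 0 = coefs f 0 * coefs g 0.
Proof. by rewrite coefsM big_ord_recl big_ord0 addr0. Qed.

Lemma coefs_sum (I : Type) (r : seq I) (P : pred I) (F : I -> fps K) n :
  coefs (\sum_(i <- r | P i) F i) n = \sum_(i <- r | P i) coefs (F i) n.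
Proof.
by apply: (big_morph (fun f => coefs f n)) => [f g|]; rewrite ?coefs0.
Qed.

Definition coef0 f := coefs f 0.

Fact coef0_is_zmod_morphism : zmod_morphism coef0.
Proof. by []. Qed.

Fact coef0_is_monoid_morphism : monoid_morphism coef0.
Proof. by split=> // f g; exact: coefsM0. Qed.

HB.instance Definition _ :=
  GRing.isZmodMorphism.Build (fps K) K coef0 coef0_is_zmod_morphism.
HB.instance Definition _ :=
  GRing.isMonoidMorphism.Build (fps K) K coef0 coef0_is_monoid_morphism.

Lemma coefsC_mul (a : K) f n : coefs (fpsC a * f) n = a * coefs f n.
Proof.
by rewrite coefsM big_ord_recl subn0 big1 ?addr0 // => i _; rewrite mul0r.
Qed.

Fact fpsC_is_zmod_morphism : zmod_morphism (@fpsC K).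
Proof.
by move=> a b; apply: fpsP => -[|n]; rewrite coefsD coefsN //= subrr.
Qed.

Fact fpsC_is_monoid_morphism : monoid_morphism (@fpsC K).
Proof.
split=> // a b; apply: fpsP => n; rewrite coefsC_mul /=.
by case: ifP => _; rewrite ?mulr0.
Qed.

HB.instance Definition _ :=
  GRing.isZmodMorphism.Build K (fps K) (@fpsC K) fpsC_is_zmod_morphism.
HB.instance Definition _ :=
  GRing.isMonoidMorphism.Build K (fps K) (@fpsC K) fpsC_is_monoid_morphism.

Lemma coef0C (a : K) : coef0 (fpsC a) = a.
Proof. by []. Qed.

(** Only the last term of the Cauchy product survives. This is the basic tool of the t-adic
    arguments below. *)
Lemma coefsM_low f g n : (forall i, (i < n)%N -> coefs f i = 0) ->
  coefs (f * g) n = coefs f n * coef0 g.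
Proof.
move=> f0; rewrite coefsM big_ord_recr /= subnn big1 ?add0r // => i _.
by rewrite f0 ?mul0r.
Qed.

Definition fpsX : fps K := Fps (fun n => (n == 1%N)%:R).

Lemma coef0X : coef0 fpsX = 0.
Proof. by []. Qed.

Lemma fps_comp0 (s : fps K) : fps_comp s 0 = 0.
Proof.
apply: fpsP => n; rewrite coefs0 /= big1 // => i _.
by rewrite if_same mul0r.
Qed.

Lemma fps_compN (s f : fps K) : fps_comp s (- f) = - fps_comp s f.
Proof.
apply: fpsP => n; rewrite coefsN /= -sumrN.
by apply: eq_bigr => i _; rewrite mulNr.
Qed.

Lemma fps_comp1 (s : fps K) : fps_comp s 1 = 1.
Proof.
apply: fpsP => n; rewrite /= big_ord_recl /= mul1r.
by rewrite big1 ?addr0 // => i _; rewrite mul0r.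
Qed.

(** In degree 0 the truncated sum stops before [k = 1] and gives 0, which agrees with [s] because
    [s] has no constant term. *)
Lemma fps_compX (s : fps K) : coef0 s = 0 -> fps_comp s fpsX = s.
Proof.
move=> s0; apply: fpsP => -[|n] /=; rewrite big_ord_recl /= mul0r add0r.
  by rewrite big_ord0; exact: esym s0.
rewrite big_ord_recl /= mul1r expr1 big1 ?addr0 // => i _.
by rewrite mul0r.
Qed.

End FpsRing.

(** * Inverses and square roots of power series over a field *)

Section FpsField.
Variable C : fieldType.
Implicit Types f g : fps C.

(** The recursion solves the equation for the coefficient of degree [n] in [f * g = 1] for its top
    unknown, which is multiplied by [coef0 f]. *)
Lemma fps_unit f : coef0 f != 0 -> exists g, f * g = 1.
Proof.
move=> f0.
have [|g gE] := @causal_fixpoint C 0 (fun n (g : nat -> C) => (coef0 f)^-1 *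
   ((n == 0%N)%:R - \sum_(i < n) coefs f i.+1 * g (n - i.+1)%N)).
  move=> n u v uv; congr (_ * (_ - _)); apply: eq_bigr => i _.
  by rewrite uv // ltn_subrL (leq_trans _ (ltn_ord i)).
exists (Fps g); apply: fpsP => n.
rewrite coefsM big_ord_recl subn0 /= gE mulVKf // subrK.
by case: n.
Qed.

Lemma coef0_inv f g : f * g = 1 -> coef0 g = (coef0 f)^-1.
Proof.
move=> fg; have fg1 : coef0 f * coef0 g = 1 by rewrite /coef0 -coefsM0 fg.
have f0 : coef0 f != 0.
  by apply/eqP => f0; move: fg1 => /eqP; rewrite f0 mul0r eq_sym oner_eq0.
by apply: (mulfI f0); rewrite fg1 mulfV.
Qed.

(** In degree [n.+1] the unknown coefficient of [g] occurs only in the two extreme terms of the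
    Cauchy square, each time multiplied by 1; hence the division by 2. *)
Lemma fps_sqrt f : (2 : C) != 0 -> coef0 f = 1 ->
  exists2 g, g ^+ 2 = f & coef0 g = 1.
Proof.
move=> two0 f0.
have [|g gE] := @causal_fixpoint C 0 (fun n (g : nat -> C) => if n is n'.+1 then
   (coefs f n - \sum_(i < n') g i.+1 * g (n' - i)%N) / 2 else 1).
  case=> [|n] u v uv //; congr ((_ - _) / _); apply: eq_bigr => i _.
  by rewrite !uv // ltnS ?leq_subr.
have g0 : g 0%N = 1 by rewrite gE.
exists (Fps g) => //; apply: fpsP => -[|n].
  by rewrite expr2 coefsM0 /= g0 mulr1.
rewrite expr2 coefsM big_ord_recl big_ord_recr /= subnn subn0 g0 mul1r mulr1.
rewrite addrCA -mulr2n -[in X in _ + X]mulr_natr gE divfK //.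
by rewrite addrC subrK.
Qed.

End FpsField.

(** * Coordinates on the superspace of dimension 4|2 *)

Section Row6.
Variable K : comNzRingType.

Definition row6 (a b c d p q : K) : 'rV[K]_(4 + 2) :=
  \row_(i < 4 + 2) nth 0 [:: a; b; c; d; p; q] i.

Lemma row6_inj a b c d p q a' b' c' d' p' q' :
  row6 a b c d p q = row6 a' b' c' d' p' q' ->
  [/\ a = a', b = b' & c = c'] /\ [/\ d = d', p = p' & q = q'].
Proof.
move=> /rowP E; have nthE k (lt_k : (k < 4 + 2)%N) := E (Ordinal lt_k).
move: (nthE 0%N isT) (nthE 1%N isT) (nthE 2%N isT) (nthE 3%N isT).
by move: (nthE 4%N isT) (nthE 5%N isT); rewrite !mxE.
Qed.

Lemma row6P (x : 'rV[K]_(4 + 2)) : exists a b c d p q, x = row6 a b c d p q.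
Proof.
pose c k (lt_k : (k < 4 + 2)%N) := x 0 (Ordinal lt_k).
exists (c 0%N isT), (c 1%N isT), (c 2%N isT), (c 3%N isT), (c 4%N isT), (c 5%N
  isT).
apply/rowP => -[k lt_k]; rewrite mxE /c.
by do 6![case: k lt_k => [|k] lt_k; first by congr (x 0 _); apply: val_inj].
Qed.

Lemma row6D a b c d p q a' b' c' d' p' q' :
  row6 a b c d p q + row6 a' b' c' d' p' q' =
  row6 (a + a') (b + b') (c + c') (d + d') (p + p') (q + q').
Proof. by apply/rowP; case; do 6?[case=> [|]] => //= i; rewrite !mxE. Qed.

Lemma row6Z k a b c d p q :
  k *: row6 a b c d p q = row6 (k * a) (k * b) (k * c) (k * d) (k * p) (k * q).
Proof. by apply/rowP; case; do 6?[case=> [|]] => //= i; rewrite !mxE. Qed.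

Lemma row6N a b c d p q :
  - row6 a b c d p q = row6 (- a) (- b) (- c) (- d) (- p) (- q).
Proof. by apply/rowP; case; do 6?[case=> [|]] => //= i; rewrite !mxE. Qed.

Lemma row60 : row6 0 0 0 0 0 0 = 0.
Proof. by apply/rowP; case; do 6?[case=> [|]] => //= i; rewrite !mxE. Qed.

Lemma eE : (e K 1 = row6 1 0 0 0 0 0) * (e K 2 = row6 0 1 0 0 0 0) *
  (e K 3 = row6 0 0 1 0 0 0) * (e K 4 = row6 0 0 0 1 0 0) *
  (e K 5 = row6 0 0 0 0 1 0) * (e K 6 = row6 0 0 0 0 0 1).
Proof.
by do !split; apply/rowP; case; do 6?[case=> [|]] => //= i; rewrite !mxE.
Qed.

Lemma homogeneous_even a b c d p q :
  homogeneous false (row6 a b c d p q) <-> p = 0 /\ q = 0.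
Proof.
split=> [h|[-> ->]].
  have := h (Ordinal (isT : 4 < 4 + 2)%N) isT.
  by have := h (Ordinal (isT : 5 < 4 + 2)%N) isT; rewrite !mxE.
by case; do 6?[case=> [|]] => //= i; rewrite !mxE.
Qed.

Lemma homogeneous_odd a b c d p q :
  homogeneous true (row6 a b c d p q) <-> [/\ a = 0, b = 0, c = 0 & d = 0].
Proof.
split=> [h|[-> -> -> ->]].
  have := h (Ordinal (isT : 0 < 4 + 2)%N) isT.
  have := h (Ordinal (isT : 1 < 4 + 2)%N) isT.
  have := h (Ordinal (isT : 2 < 4 + 2)%N) isT.
  by have := h (Ordinal (isT : 3 < 4 + 2)%N) isT; rewrite !mxE.
by case; do 6?[case=> [|]] => //= i; rewrite !mxE.
Qed.

End Row6.

Lemma map_row6 (K L : comNzRingType) (f : K -> L) a b c d p q :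
  map_mx f (row6 a b c d p q) =
  row6 (f a) (f b) (f c) (f d) (f p) (f q).
Proof. by apply/rowP; case; do 6?[case=> [|]] => //= i; rewrite !mxE. Qed.

(** * The normal forms [fam s]: brackets, Lie superalgebra axioms and invariant form *)

Section Fam.
Variable K : comNzRingType.

Definition structure_constant (T : nat -> nat -> 'rV[K]_(4 + 2)) (i j : nat) :=
  if (i <= j)%N then T i.+1 j.+1
  else - ((-1) ^+ ((4 <= i)%N && (4 <= j)%N) *: T j.+1 i.+1).

Lemma bracket_ofE T x y :
  bracket_of T x y = \sum_(i < 4 + 2) \sum_(j < 4 + 2) (x 0 i * y 0 j) *:
    structure_constant T i j.
Proof. by []. Qed.

Lemma bracket_of_delta T (i j : 'I_(4 + 2)) :
  bracket_of T (delta_mx 0 i) (delta_mx 0 j) = structure_constant T i j.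
Proof.
rewrite bracket_ofE (bigD1 i) //= (bigD1 j) //= !mxE !eqxx mul1r scale1r.
rewrite big1 ?addr0 => [|k ne_kj]; last first.
  by rewrite !mxE eqxx /= (negbTE ne_kj) mulr0 scale0r.
rewrite big1 ?addr0 // => k ne_ki; rewrite big1 // => l _.
by rewrite !mxE eqxx /= (negbTE ne_ki) mul0r scale0r.
Qed.

(* At s = 0 this is g42_1; over C it is isomorphic to g42_2 lambda whenever
   lambda ^ 2 = s and s != 0. *)
Definition fam_table (s : K) (k l : nat) : 'rV[K]_(4 + 2) :=
  match k, l with
  | 1, 2 => e K 2
  | 1, 3 => - e K 3
  | 2, 3 => e K 4
  | 1, 5 => s *: e K 6
  | 1, 6 => e K 5
  | 5, 5 => - s *: e K 4
  | 6, 6 => e K 4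
  | _, _ => 0
  end.

Definition fam (s : K) := bracket_of (fam_table s).

Lemma fam_row6 s a b c d p q a' b' c' d' p' q' :
  fam s (row6 a b c d p q) (row6 a' b' c' d' p' q') =
  row6 0 (a * b' - b * a') (c * a' - a * c')
    (b * c' - c * b' - s * (p * p') + q * q')
    (a * q' - q * a') (s * (a * p' - p * a')).
Proof.
rewrite /fam /bracket_of !big_ord_recl !big_ord0 !mxE /=.
rewrite !eE -row60 !(row6Z, row6N, row6D).
by congr row6; ring.
Qed.

End Fam.

Section FamProperties.
Variable K : comNzRingType.

Lemma bracket_of_linearl T y : linear (@bracket_of K T ^~ y).
Proof.
move=> a u v; rewrite !bracket_ofE scaler_sumr -big_split /=.
apply: eq_bigr => i _; rewrite scaler_sumr -big_split /=.
by apply: eq_bigr => j _; rewrite !mxE scalerA -scalerDl mulrDl mulrA.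
Qed.

Lemma bracket_of_linearr T x : linear (@bracket_of K T x).
Proof.
move=> a u v; rewrite !bracket_ofE scaler_sumr -big_split /=.
apply: eq_bigr => i _; rewrite scaler_sumr -big_split /=.
by apply: eq_bigr => j _; rewrite !mxE scalerA -scalerDl mulrDr mulrCA.
Qed.

Lemma fam_lie_superalgebra (s : K) : lie_superalgebra (fam s).
Proof.
split; first split.
- exact: bracket_of_linearl.
- exact: bracket_of_linearr.
- move=> p q x y; case: (row6P x) => [a [b [c [d [g [h ->]]]]]].
  case: (row6P y) => [a' [b' [c' [d' [g' [h' ->]]]]]]; rewrite fam_row6.
  case: p => [/homogeneous_odd[? ? ? ?]|/homogeneous_even[? ?]]; subst;
  case: q => [/homogeneous_odd[? ? ? ?]|/homogeneous_even[? ?]]; subst;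
  rewrite /addb /=;
    [apply/homogeneous_even|apply/homogeneous_odd..|apply/homogeneous_even];
  by split; ring.
- move=> p q x y; case: (row6P x) => [a [b [c [d [g [h ->]]]]]].
  case: (row6P y) => [a' [b' [c' [d' [g' [h' ->]]]]]]; rewrite !fam_row6.
  case: p => [/homogeneous_odd[? ? ? ?]|/homogeneous_even[? ?]]; subst;
  case: q => [/homogeneous_odd[? ? ? ?]|/homogeneous_even[? ?]]; subst;
  by rewrite /= ?(row6Z, row6N); congr row6; ring.
move=> p q r x y z; case: (row6P x) => [a [b [c [d [g [h ->]]]]]].
case: (row6P y) => [a' [b' [c' [d' [g' [h' ->]]]]]].
case: (row6P z) => [a1 [b1 [c1 [d1 [g1 [h1 ->]]]]]]; rewrite !fam_row6.
case: p => [/homogeneous_odd[? ? ? ?]|/homogeneous_even[? ?]]; subst;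
case: q => [/homogeneous_odd[? ? ? ?]|/homogeneous_even[? ?]]; subst;
case: r => [/homogeneous_odd[? ? ? ?]|/homogeneous_even[? ?]]; subst;
by rewrite /= row6Z row6D; congr row6; ring.
Qed.

(** The even part is a sum of two hyperbolic planes, pairing [e 1] with [e 4] and [e 2] with [e 3];
    the odd part is a symplectic plane. The same form serves for every [s]. *)
Definition fam_form (x y : 'rV[K]_(4 + 2)) : K :=
  let c (z : 'rV[K]_(4 + 2)) k := z 0 (inord k : 'I_6) in
  c x 0%N * c y 3 + c x 3 * c y 0%N + c x 1%N * c y 2 + c x 2 * c y 1%N
  + c x 4 * c y 5 - c x 5 * c y 4.

Lemma fam_form_row6 a b c d p q a' b' c' d' p' q' :
  fam_form (row6 a b c d p q) (row6 a' b' c' d' p' q') =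
  a * d' + d * a' + b * c' + c * b' + p * q' - q * p'.
Proof. by rewrite /fam_form !mxE !inordK. Qed.

Lemma fam_metric_form (s : K) : metric_form (fam s) fam_form.
Proof.
split.
- by move=> y k u v; rewrite /fam_form !mxE; ring.
- by move=> y k u v; rewrite /fam_form !mxE; ring.
- move=> p q x y; case: (row6P x) => [a [b [c [d [g [h ->]]]]]].
  case: (row6P y) => [a' [b' [c' [d' [g' [h' ->]]]]]]; rewrite fam_form_row6.
  case: p => [/homogeneous_odd[? ? ? ?]|/homogeneous_even[? ?]]; subst;
  case: q => [/homogeneous_odd[? ? ? ?]|/homogeneous_even[? ?]] _ //; subst;
  by ring.
- move=> p q x y; case: (row6P x) => [a [b [c [d [g [h ->]]]]]].
  case: (row6P y) => [a' [b' [c' [d' [g' [h' ->]]]]]]; rewrite !fam_form_row6.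
  case: p => [/homogeneous_odd[? ? ? ?]|/homogeneous_even[? ?]]; subst;
  case: q => [/homogeneous_odd[? ? ? ?]|/homogeneous_even[? ?]]; subst;
  by rewrite /=; ring.
- move=> x y z; case: (row6P x) => [a [b [c [d [g [h ->]]]]]].
  case: (row6P y) => [a' [b' [c' [d' [g' [h' ->]]]]]].
  case: (row6P z) => [a1 [b1 [c1 [d1 [g1 [h1 ->]]]]]].
  by rewrite !fam_row6 !fam_form_row6; ring.
move=> f fl.
have fE a b c d p q : f (row6 a b c d p q) =
    a * f (e K 1) + b * f (e K 2) + c * f (e K 3) + d * f (e K 4) +
    p * f (e K 5) + q * f (e K 6).
  have f0 : f 0 = 0 by have := fl (-1) 0 0; rewrite !scaler0 addr0 mulN1r addNr.
  have fD u v : f (u + v) = f u + f v.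
    by have := fl 1 u v; rewrite scale1r mul1r.
  have fZ k u : f (k *: u) = k * f u by have := fl k u 0; rewrite f0 !addr0.
  rewrite -!fZ -!fD !eE !row6Z !row6D.
  by congr (f _); congr row6; ring.
(* The coordinates are the values of [f] on the dual basis for [fam_form]; the last sign reflects
   that the form is -1 on the pair [e 6], [e 5]. *)
exists (row6 (f (e K 4)) (f (e K 3)) (f (e K 2)) (f (e K 1)) (f (e K 6)) (- f
  (e K 5))).
split=> [y|y].
  case: (row6P y) => [a' [b' [c' [d' [g' [h' ->]]]]]].
  by rewrite fam_form_row6 fE; ring.
case: (row6P y) => [a [b [c [d [g [h ->]]]]]] yE.
by rewrite -!yE !eE !fam_form_row6; congr row6; ring.
Qed.

Lemma fam_is_metric (s : K) : metric (fam s).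
Proof.
split; first exact: fam_lie_superalgebra.
by exists fam_form; exact: fam_metric_form.
Qed.

Lemma g42_1E : @g42_1 K = fam 0.
Proof.
apply/funext => x; apply/funext => y; rewrite /fam /g42_1 !bracket_ofE.
apply: eq_bigr => i _; apply: eq_bigr => j _; congr (_ *: _).
case: i j => [i lt_i] [j lt_j]; rewrite /structure_constant /=.
by do 6?[case: i lt_i => [|i] lt_i] => //; do 6?[case: j lt_j => [|j] lt_j] =>
  //=;
  rewrite ?oppr0 ?scale0r.
Qed.

Lemma g42_2_row6 l a b c d p q a' b' c' d' p' q' :
  @g42_2 K l (row6 a b c d p q) (row6 a' b' c' d' p' q') =
  row6 0 (a * b' - b * a') (c * a' - a * c')
    (b * c' - c * b' + l * (p * q' + q * p'))
    (l * (a * p' - p * a')) (l * (q * a' - a * q')).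
Proof.
rewrite /g42_2 /bracket_of !big_ord_recl !big_ord0 !mxE /=.
rewrite !eE -row60 !(row6Z, row6N, row6D).
by congr row6; ring.
Qed.

End FamProperties.

(** All structure constants lie among 0, 1, -1, [s] and [- s], so [f] need not be a ring morphism.
    This lets the lemma apply directly to substitution and evaluation of series. *)
Lemma base_change_fam (K L : comNzRingType) (f : K -> L) (s : K) :
    f 0 = 0 -> f 1 = 1 -> f (- 1) = - 1 -> f (- s) = - f s ->
  base_change f (fam s) = fam (f s).
Proof.
move=> f0 f1 fN1 fNs; apply/funext => x; apply/funext => y.
rewrite /base_change [fam (f s)]/fam bracket_ofE.
apply: eq_bigr => i _; apply: eq_bigr => j _; congr (_ *: _).
rewrite [fam s]/fam bracket_of_delta.
case: i j => [i lt_i] [j lt_j]; rewrite /structure_constant /=.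
by do 6?[case: i lt_i => [|i] lt_i] => //; do 6?[case: j lt_j => [|j] lt_j] =>
  //=;
  do ?rewrite eE; rewrite -?(row60 K) -?(row60 L); do ?rewrite (row6Z, row6N);
  rewrite map_row6;
  congr row6; do ?rewrite (mul0r, mulr0, mulr1, mul1r, mulN1r, oppr0, opprK,
    f0, f1, fN1, fNs).
Qed.

Lemma map_fam (K L : comNzRingType) (f : {rmorphism K -> L}) (s : K) x y :
  map_mx f (fam s x y) = fam (f s) (map_mx f x) (map_mx f y).
Proof.
case: (row6P x) => [a [b [c [d [g [h ->]]]]]].
case: (row6P y) => [a' [b' [c' [d' [g' [h' ->]]]]]].
rewrite fam_row6 !map_row6 fam_row6.
by congr row6; rewrite ?rmorph0 ?(rmorphD, rmorphB, rmorphN, rmorphM).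
Qed.

Lemma homogeneous_map (K L : comNzRingType) (f : K -> L) m n p
    (x : 'rV[K]_(m + n)) :
  f 0 = 0 -> homogeneous p x -> homogeneous p (map_mx f x).
Proof. by move=> f0 px i pi; rewrite mxE px. Qed.

Lemma homogeneousZ (K : comNzRingType) m n p (k : K) (x : 'rV[K]_(m + n)) :
  homogeneous p x -> homogeneous p (k *: x).
Proof. by move=> px i pi; rewrite !mxE px // !mulr0. Qed.

Lemma homogeneousD (K : comNzRingType) m n p (x y : 'rV[K]_(m + n)) :
  homogeneous p x -> homogeneous p y -> homogeneous p (x + y).
Proof. by move=> px py i pi; rewrite !mxE px // py // addr0. Qed.

Lemma homogeneousN (K : comNzRingType) m n p (x : 'rV[K]_(m + n)) :
  homogeneous p x -> homogeneous p (- x).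
Proof. by move=> px i pi; rewrite !mxE px // oppr0. Qed.

(** Taking the coefficient of degree [i] is linear over the constants, preserves parity and commutes
    with signs, so each condition passes from the deformed bracket to its terms. *)
Lemma deformation_term_even_super_skew (C : comNzRingType) m n
    (brt : 'rV[fps C]_(m + n) -> 'rV[fps C]_(m + n) -> 'rV[fps C]_(m + n)) i :
  even_super_skew brt -> even_super_skew (deformation_term brt i).
Proof.
case=> linl linr even skew.
have hC p (x : 'rV[C]_(m + n)) : homogeneous p x ->
  homogeneous p (map_mx (@fpsC C) x) by apply: homogeneous_map; rewrite rmorph0.
have lin (a : C) (u v : 'rV[fps C]_(m + n)) :
    map_mx (fun f => coefs f i) (fpsC a *: u + v) =
    a *: map_mx (fun f => coefs f i) u + map_mx (fun f => coefs f i) v.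
  by apply/rowP => k; rewrite !mxE coefsD coefsC_mul.
split=> [y a u v|x a u v|p q x y px qy|p q x y px qy]; rewrite
  /deformation_term.
- by rewrite map_mxD map_mxZ linl lin.
- by rewrite map_mxD map_mxZ linr lin.
- by apply: homogeneous_map; rewrite ?coefs0 //; apply: even; apply: hC.
rewrite (skew p q) //; try exact: hC.
by apply/rowP => k; rewrite !mxE coefsN; case: (p && q);
  rewrite ?expr1 ?expr0 ?mulN1r ?mul1r.
Qed.

Lemma fam_deformation (C : comNzRingType) (s : fps C) :
  coef0 s = 0 -> deformation (@g42_1 C) (fam s).
Proof.
move=> s0; split; first exact: fam_lie_superalgebra.
  move=> x y; rewrite g42_1E -s0.
  have xC (z : 'rV[C]_(4 + 2)) : map_mx (@coef0 C) (map_mx (@fpsC C) z) = z.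
    by apply/rowP => i; rewrite !mxE.
  rewrite -[x in RHS]xC -[y in RHS]xC.
  exact: (map_fam (@coef0 C)).
move=> i _; apply: deformation_term_even_super_skew.
by case: (fam_lie_superalgebra s).
Qed.

(** * Morphisms between members of the family *)

Section FamMorphism.
Variables (K : comNzRingType) (s s' : K).
Variable psi : 'rV[K]_(4 + 2) -> 'rV[K]_(4 + 2).
Hypothesis psi_even : even_linear psi.
Hypothesis psi_br : forall x y, psi (fam s x y) = fam s' (psi x) (psi y).

Lemma even_linear0 : psi 0 = 0.
Proof.
case: psi_even => psi_lin _.
by have := psi_lin (-1) 0 0; rewrite scaler0 addr0 scaleN1r addNr.
Qed.

Lemma even_linearZ k x : psi (k *: x) = k *: psi x.
Proof.
case: psi_even => psi_lin _.
by have := psi_lin k x 0; rewrite even_linear0 !addr0.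
Qed.

Lemma even_linear_e1 : exists a b c d, psi (e K 1) = row6 a b c d 0 0.
Proof.
case: psi_even => _ psi_hom.
have : homogeneous false (psi (e K 1)).
  by apply: psi_hom; rewrite eE; apply/homogeneous_even.
case: (row6P (psi (e K 1))) => [a [b [c [d [p [q ->]]]]]].
by move=> /homogeneous_even[-> ->]; exists a, b, c, d.
Qed.

Lemma even_linear_e5 : exists p q, psi (e K 5) = row6 0 0 0 0 p q.
Proof.
case: psi_even => _ psi_hom.
have : homogeneous true (psi (e K 5)).
  by apply: psi_hom; rewrite eE; apply/homogeneous_odd.
case: (row6P (psi (e K 5))) => [a [b [c [d [p [q ->]]]]]].
by move=> /homogeneous_odd[-> -> -> ->]; exists p, q.
Qed.

(* On the odd part, ad e1 squares to s and ad (psi e1) to a ^+ 2 * s'. *)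
Lemma fam_morphism_odd a b c d : psi (e K 1) = row6 a b c d 0 0 ->
  s *: psi (e K 5) = (a ^+ 2 * s') *: psi (e K 5).
Proof.
move=> E1; rewrite -even_linearZ.
have <- : fam s (e K 1) (fam s (e K 1) (e K 5)) = s *: e K 5.
  by rewrite !eE !fam_row6 row6Z; congr row6; ring.
rewrite !psi_br E1; have [p [q ->]] := even_linear_e5.
by rewrite !fam_row6 row6Z; congr row6; ring.
Qed.

End FamMorphism.

(** With [a] the first coordinate of the image of [e 1], the action on [e 2] forces [a ^+ 2 = 1];
    the odd part then compares [s] with [s']. *)
Lemma fam_isomorphic_eq (F : fieldType) (s s' : F) :
  isomorphic (fam s) (fam s') -> s = s'.
Proof.
case=> psi [psi_even psi_bij psi_br].
have psi_neq0 x : x <> 0 -> psi x <> 0.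
  move=> x0 px0; apply/x0/(bij_inj psi_bij).
  by rewrite px0 even_linear0.
have [a [b [c [d E1]]]] := even_linear_e1 psi_even.
have a2 : a ^+ 2 = 1.
  have : psi (e F 2) = fam s' (psi (e F 1)) (fam s' (psi (e F 1)) (psi (e F
    2))).
    rewrite -!psi_br; congr psi; rewrite !eE !fam_row6.
    by congr row6; ring.
  have : psi (e F 2) <> 0.
    by apply: psi_neq0; rewrite eE -row60 => /row6_inj[[_ /eqP]]; rewrite
      oner_eq0.
  have [_ psi_hom] := psi_even.
  have : homogeneous false (psi (e F 2)).
    by apply: psi_hom; rewrite eE; apply/homogeneous_even.
  rewrite E1; case: (row6P (psi (e F 2))) => [x [y [z [w [p [q ->]]]]]].
  move=> /homogeneous_even[-> ->] nz; rewrite !fam_row6 => /row6_inj[[x0 y0 z0]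
    [w0 _ _]].
  rewrite x0 in y0 z0 w0 nz *.
  (* Otherwise the fixed-point equation kills first the coordinates [y] and [z], each multiplied by
     [a ^+ 2], and then [w], so that the image of [e 2] would vanish. *)
  have [|na] := eqVneq (a ^+ 2) 1; first by [].
  have na1 : 1 - a ^+ 2 != 0 by rewrite subr_eq0 eq_sym.
  have y1 : y = 0.
    apply: (mulfI na1); rewrite mulr0 mulrBl mul1r; apply/eqP; rewrite subr_eq0.
    by apply/eqP; rewrite {1}y0; ring.
  have z1 : z = 0.
    apply: (mulfI na1); rewrite mulr0 mulrBl mul1r; apply/eqP; rewrite subr_eq0.
    by apply/eqP; rewrite {1}z0; ring.
  by case: nz; rewrite w0 y1 z1 -row60; congr row6; ring.
have : s *: psi (e F 5) = s' *: psi (e F 5).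
  by rewrite (fam_morphism_odd psi_even psi_br E1) a2 mul1r.
move/eqP; rewrite -subr_eq0 -scalerBl scaler_eq0 subr_eq0 => /orP[/eqP//|/eqP
  psi50].
case: (psi_neq0 (e F 5)) => //.
by rewrite eE -row60 => /row6_inj[_ [_ /eqP]]; rewrite oner_eq0.
Qed.

Lemma base_change_g42_1 (C : comNzRingType) :
  base_change (@fpsC C) (@g42_1 C) = fam 0.
Proof.
rewrite g42_1E -[in RHS](rmorph0 (@fpsC C)).
apply: base_change_fam; [exact: rmorph0|by []|exact: rmorphN1|exact: rmorphN].
Qed.

(** An equivalence with [fam 0] would give t * psi(e5) = 0, whereas psi(e5) is [e 5] modulo t. *)
Lemma famX_nontrivial (C : comNzRingType) :
  ~ trivial_deformation (@g42_1 C) (fam (fpsX C)).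
Proof.
case=> psi [psi_even psi_id psi_br].
rewrite base_change_g42_1 in psi_br.
have [a [b [c [d E1]]]] := even_linear_e1 psi_even.
have := fam_morphism_odd psi_even psi_br E1; rewrite mulr0 scale0r.
have := psi_id (e C 5).
have -> : map_mx (@fpsC C) (e C 5) = e (fps C) 5.
  by rewrite !eE map_row6 !rmorph0 rmorph1.
have [p [q ->]] := even_linear_e5 psi_even.
rewrite map_row6 eE => /row6_inj[_ [_ p0 _]].
rewrite row6Z -row60 => /row6_inj[_ [_ + _]].
move=> /(congr1 (fun f => coefs f 1)); rewrite coefs0 mulrC coefsM.
rewrite big_ord_recl big_ord_recl big_ord0 /= p0 mul1r mulr0 !addr0.
by move/eqP; rewrite oner_eq0.
Qed.

(** * Convergence and specialization of [fam (fpsX C)] *)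

Section Convergence.
Variable C : numClosedFieldType.
Implicit Types (t : C) (f : fps C).

(* Polynomials of degree at most 1, the only series occurring in fam fpsX. *)
Definition affine_fps f := forall k, (1 < k)%N -> coefs f k = 0.

Lemma affine_fpsD f g : affine_fps f -> affine_fps g -> affine_fps (f + g).
Proof. by move=> fa ga k k1; rewrite coefsD fa // ga // addr0. Qed.

Lemma affine_fpsN f : affine_fps f -> affine_fps (- f).
Proof. by move=> fa k k1; rewrite coefsN fa // oppr0. Qed.

Lemma affine_fpsC a : affine_fps (fpsC a).
Proof. by case. Qed.

Lemma affine_fpsX a : affine_fps (fpsX C * fpsC a).
Proof. by move=> k k1; rewrite mulrC coefsC_mul /= gtn_eqF // mulr0. Qed.

Lemma cvg_affine_fps t f : affine_fps f ->
  fps_series t f @ \oo --> coefs f 0 + coefs f 1 * t.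
Proof.
move=> fa; apply: cvg_near_cst.
exists 2%N => // n /= n2; rewrite /fps_series /series /=.
rewrite -(subnKC n2) /index_iota subn0 iotaD big_cat /= !big_cons big_nil.
rewrite expr0 mulr1 expr1 addr0 big1_seq ?addr0 // => k.
by rewrite mem_iota => /andP[_ /andP[k2 _]]; rewrite fa ?mul0r.
Qed.

Lemma fps_eval_affine t f : affine_fps f ->
  fps_eval t f = coefs f 0 + coefs f 1 * t.
Proof. by move=> fa; apply/cvg_lim/cvg_affine_fps. Qed.

Lemma famX_converges t : converges_at (fam (fpsX C)) t.
Proof.
move=> i j k.
suff : affine_fps (fam (fpsX C) (delta_mx 0 i) (delta_mx 0 j) 0 k).
  by move=> fa; apply/cvg_ex; eexists; exact: (cvg_affine_fps (t := t) fa).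
(* The basis vectors are constant, so every entry of their bracket is a sum of constants and of
   constant multiples of t. *)
rewrite -!(map_delta_mx (@fpsC C)).
case: (@row6P C (delta_mx 0 i)) => [a [b [c [d [p [q ->]]]]]].
case: (@row6P C (delta_mx 0 j)) => [a' [b' [c' [d' [p' [q' ->]]]]]].
rewrite !map_row6 fam_row6 -!rmorphM -!rmorphB mxE.
case: k; do 6?[case=> [|]] => //= _.
- exact: (affine_fpsC 0).
- exact: affine_fpsC.
- exact: affine_fpsC.
- apply: affine_fpsD (affine_fpsC _); apply: affine_fpsD (affine_fpsC _) _.
  exact/affine_fpsN/affine_fpsX.
- exact: affine_fpsC.
- exact: affine_fpsX.
Qed.

Lemma specialize_famX t : specialize (fam (fpsX C)) t = fam t.
Proof.
have evC a : fps_eval t (fpsC a) = a.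
  by rewrite fps_eval_affine /= ?mul0r ?addr0 //; exact: affine_fpsC.
have Xa : affine_fps (fpsX C) by rewrite -[fpsX C]mulr1; exact: (affine_fpsX 1).
have evX : fps_eval t (fpsX C) = t.
  by rewrite fps_eval_affine //= mul1r add0r.
rewrite /specialize -[in RHS]evX; apply: base_change_fam.
- by rewrite -[LHS]/(fps_eval t (fpsC 0)) evC.
- by rewrite -[LHS]/(fps_eval t (fpsC 1)) evC.
- by rewrite -(rmorphN1 (@fpsC C)) evC.
rewrite evX fps_eval_affine; last exact: affine_fpsN.
by rewrite !coefsN /= oppr0 add0r mulN1r.
Qed.

(** Squaring turns the required bound into a bound on the norm of t by [eps ^+ 2]; the continuity of
    the chosen branch is not involved. *)
Lemma sqrtC_cvg0 : (sqrtC t : C) @[t --> (0 : C)^'] --> (0 : C).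
Proof.
apply/cvgrPdist_lt => eps eps0; near=> t.
rewrite sub0r normrN -(ltr_pXn2r (n := 2)) ?nnegrE ?normr_ge0 ?(ltW eps0) //.
rewrite -normrX sqrtCK; near: t.
by apply: dnbhs0_lt; rewrite exprn_gt0.
Unshelve. all: by end_near.
Qed.

End Convergence.

(** * Calculus of brackets and invariant forms *)

Section Bilinear.
Variables (K : comNzRingType) (n : nat).

Lemma linear0E (f : 'rV[K]_n -> 'rV[K]_n) : linear f -> f 0 = 0.
Proof.
by move=> fl; have := fl (-1) 0 0; rewrite scaler0 addr0 scaleN1r addNr.
Qed.

Lemma scalar0E (f : 'rV[K]_n -> K) : scalar f -> f 0 = 0.
Proof.
by move=> fl; have := fl (-1) 0 0; rewrite scaler0 addr0 mulN1r addNr.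
Qed.

Lemma linear_sum_scale (f : 'rV[K]_n -> 'rV[K]_n) (I : Type) (r : seq I) (k : I
  -> K) (v : I -> 'rV[K]_n) :
  linear f -> f (\sum_(i <- r) k i *: v i) = \sum_(i <- r) k i *: f (v i).
Proof.
move=> fl; have f0 := linear0E fl.
by elim: r => [|i r IHr]; rewrite ?big_nil // !big_cons fl IHr.
Qed.

End Bilinear.

(** The scalar [h] stands for 1/2, since [K] is only a ring; it is a constant series in the
    application. *)
Lemma double_eq0 (K : comNzRingType) (V : lmodType K) (h : K) (v : V) :
  2 * h = 1 -> v + v = 0 -> v = 0.
Proof.
move=> h2 vv; rewrite -[v]scale1r -h2 mulrC -scalerA scaler_nat mulr2n vv.
exact: scaler0.
Qed.

Section SuperBracket.
Variables (K : comNzRingType) (m n : nat).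
Local Notation V := 'rV[K]_(m + n).
Implicit Types x y z : V.
Variables (br : V -> V -> V) (h : K).
Hypotheses (h2 : 2 * h = 1) (br_lie : lie_superalgebra br).

Let ess : even_super_skew br := br_lie.1.

Lemma br0l x : br 0 x = 0.
Proof. exact: (linear0E (br_linearl ess x)). Qed.

Lemma br0r x : br x 0 = 0.
Proof. exact: (linear0E (br_linearr ess x)). Qed.

Lemma brZl k x y : br (k *: x) y = k *: br x y.
Proof. by have := br_linearl ess y k x 0; rewrite br0l !addr0. Qed.

Lemma brZr k x y : br x (k *: y) = k *: br x y.
Proof. by have := br_linearr ess x k y 0; rewrite br0r !addr0. Qed.

Lemma brDl x y z : br (x + y) z = br x z + br y z.
Proof. by have := br_linearl ess z 1 x y; rewrite !scale1r. Qed.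

Lemma brDr x y z : br z (x + y) = br z x + br z y.
Proof. by have := br_linearr ess z 1 x y; rewrite !scale1r. Qed.

Lemma brNl x y : br (- x) y = - br x y.
Proof. by rewrite -scaleN1r brZl scaleN1r. Qed.

Lemma skew_even p x y :
  homogeneous false x -> homogeneous p y -> br y x = - br x y.
Proof. by move=> x0 yp; rewrite (br_skew ess x0 yp) scale1r. Qed.

Lemma skew_odd x y : homogeneous true x -> homogeneous true y -> br y x = br x
  y.
Proof. by move=> x1 y1; rewrite (br_skew ess x1 y1) scaleN1r opprK. Qed.

Lemma br_hom p q x y : homogeneous p x -> homogeneous q y ->
  homogeneous (p (+) q) (br x y).
Proof. exact: br_even. Qed.

Lemma jacobi_even p q x y z :
  homogeneous false x -> homogeneous p y -> homogeneous q z ->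
  br x (br y z) = br (br x y) z + br y (br x z).
Proof. by move=> x0 yp zq; rewrite (br_lie.2 _ _ _ _ _ _ x0 yp zq) scale1r. Qed.

Lemma jacobi_odd p x y z :
  homogeneous true x -> homogeneous true y -> homogeneous p z ->
  br x (br y z) = br (br x y) z - br y (br x z).
Proof. by move=> x0 yp zq; rewrite (br_lie.2 _ _ _ _ _ _ x0 yp zq) scaleN1r.
  Qed.

Lemma br_self x : homogeneous false x -> br x x = 0.
Proof. by move=> x0; apply: (double_eq0 h2); rewrite {1}(skew_even x0 x0)
  addNr. Qed.

Variable B : V -> V -> K.
Hypothesis B_form : metric_form br B.

Lemma form0l x : B 0 x = 0.
Proof. exact: (scalar0E (form_scalarl B_form x)). Qed.

Lemma form0r x : B x 0 = 0.
Proof. exact: (scalar0E (form_scalarr B_form x)). Qed.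

Lemma formZl k x y : B (k *: x) y = k * B x y.
Proof. by have := form_scalarl B_form y k x 0; rewrite form0l !addr0. Qed.

Lemma formZr k x y : B x (k *: y) = k * B x y.
Proof. by have := form_scalarr B_form x k y 0; rewrite form0r !addr0. Qed.

Lemma formDl x y z : B (x + y) z = B x z + B y z.
Proof. by have := form_scalarl B_form z 1 x y; rewrite !mul1r !scale1r. Qed.

Lemma form_sym p x y : homogeneous false x -> homogeneous p y -> B y x = B x y.
Proof. by move=> x0 yp; rewrite (form_supersym B_form x0 yp) mul1r. Qed.

Lemma form_skew x y : homogeneous true x -> homogeneous true y -> B y x = - B x
  y.
Proof. by move=> x1 y1; rewrite (form_supersym B_form x1 y1) expr1 mulN1r. Qed.

Lemma form_odd_self x : homogeneous true x -> B x x = 0.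
Proof.
move=> x1; apply: (@double_eq0 K K^o _ _ h2); rewrite {1}(form_skew x1 x1).
exact: addNr.
Qed.

End SuperBracket.

(** * Frames, and the isomorphism with [g42_2] *)

Section Frame.
Variable K : comNzRingType.
Local Notation V := 'rV[K]_(4 + 2).

(** The frame vectors are the rows, so right multiplication by the matrix sends a coordinate row to
    the vector it represents. *)
Definition frame (g1 g2 g3 g4 g5 g6 : V) : 'M[K]_(4 + 2) :=
  \matrix_(i < 4 + 2) nth 0 [:: g1; g2; g3; g4; g5; g6] i.

Lemma mul_frame g1 g2 g3 g4 g5 g6 a b c d p q :
  row6 a b c d p q *m frame g1 g2 g3 g4 g5 g6 =
  a *: g1 + b *: g2 + c *: g3 + d *: g4 + p *: g5 + q *: g6.
Proof.
rewrite mulmx_sum_row !big_ord_recl big_ord0 !rowK !mxE /=.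
by rewrite addr0 !addrA.
Qed.

Lemma map_frame (L : comNzRingType) (f : L -> K) (g1 g2 g3 g4 g5 g6 : 'rV[L]_(4
  + 2)) :
  f 0 = 0 -> map_mx f (\matrix_(i < 4 + 2) nth 0 [:: g1; g2; g3; g4; g5; g6] i)
    =
  frame (map_mx f g1) (map_mx f g2) (map_mx f g3) (map_mx f g4) (map_mx f g5)
    (map_mx f g6).
Proof.
by move=> f0; apply/matrixP; case; do 6?[case=> [|]] => //= i j; rewrite !mxE
  /= ?mxE.
Qed.

Lemma frame_e : frame (e K 1) (e K 2) (e K 3) (e K 4) (e K 5) (e K 6) = 1%:M.
Proof.
by apply/matrixP; case; do 6?[case=> [|]] => //= i j; rewrite !mxE /= ?mxE
  -val_eqE eq_sym.
Qed.

(** By bilinearity it is enough to compare the two sides on pairs of frame vectors; the pairs in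
    decreasing order follow from super-skew-symmetry. *)
Lemma frame_morphism (br : V -> V -> V) (s h : K) g1 g2 g3 g4 g5 g6 :
    2 * h = 1 -> lie_superalgebra br ->
    [/\ homogeneous false g1, homogeneous false g2, homogeneous false g3 &
        homogeneous false g4] ->
    homogeneous true g5 -> homogeneous true g6 ->
    [/\ br g1 g2 = g2, br g1 g3 = - g3 & br g2 g3 = g4] ->
    [/\ br g1 g4 = 0, br g2 g4 = 0 & br g3 g4 = 0] ->
    [/\ br g1 g5 = s *: g6, br g2 g5 = 0, br g3 g5 = 0 & br g4 g5 = 0] ->
    [/\ br g1 g6 = g5, br g2 g6 = 0, br g3 g6 = 0 & br g4 g6 = 0] ->
    [/\ br g5 g5 = - s *: g4, br g5 g6 = 0 & br g6 g6 = g4] ->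
  let F := frame g1 g2 g3 g4 g5 g6 in
  forall x y, br (x *m F) (y *m F) = fam s x y *m F.
Proof.
move=> h2 br_lie [e1 e2 e3 e4] o5 o6 [r12 r13 r23] [r14 r24 r34].
move=> [r15 r25 r35 r45] [r16 r26 r36 r46] [r55 r56 r66] F x y.
have [linl linr _ skew] := br_lie.1.
have r65 : br g6 g5 = 0 by rewrite (skew true true g5 g6) // r56 scaler0 oppr0.
rewrite /fam bracket_ofE mulmx_suml [x *m F]mulmx_sum_row.
rewrite (@linear_sum_scale _ _ (br^~ (y *m F))) //; apply: eq_bigr => i _.
rewrite mulmx_suml [y *m F]mulmx_sum_row linear_sum_scale // scaler_sumr.
apply: eq_bigr => j _; rewrite -scalemxAl scalerA; congr (_ *: _).
have eF : (e K 1 *m F = g1) * (e K 2 *m F = g2) * (e K 3 *m F = g3) *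
    (e K 4 *m F = g4) * (e K 5 *m F = g5) * (e K 6 *m F = g6).
  by rewrite !eE !mul_frame !scale0r !scale1r !(add0r, addr0).
have self u : homogeneous false u -> br u u = 0 by exact: (br_self h2 br_lie).
have swap := (skew_even br_lie e1 e2, skew_even br_lie e1 e3, skew_even br_lie
  e2 e3, skew_even br_lie e1 e4,
  skew_even br_lie e2 e4, skew_even br_lie e3 e4, skew_even br_lie e1 o5,
    skew_even br_lie e2 o5,
  skew_even br_lie e3 o5, skew_even br_lie e4 o5, skew_even br_lie e1 o6,
    skew_even br_lie e2 o6,
  skew_even br_lie e3 o6, skew_even br_lie e4 o6).
rewrite !rowK; case: i j => [i lt_i] [j lt_j]; rewrite /structure_constant /=.
do 6?[case: i lt_i => [|i] lt_i] => //; do 6?[case: j lt_j => [|j] lt_j] => //=;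
  rewrite ?(mulNmx, eF, mul0mx) -?scalemxAl ?(eF, mul0mx, scaler0, oppr0);
  rewrite ?(r12, r13, r23, r14, r24, r34, r15, r25, r35, r45);
  rewrite ?(r16, r26, r36, r46, r55, r56, r66, r65) ?self //.
all: by rewrite swap ?mulNmx ?eF ?scale1r ?(r12, r13, r23, r14, r24, r34)
  ?(r15, r25, r35, r45, r16, r26, r36, r46) ?oppr0.
Qed.

End Frame.

Lemma fam_isomorphic_g42_2 (F : fieldType) (l : F) : (2 : F) != 0 -> l != 0 ->
  isomorphic (fam (l ^+ 2)) (@g42_2 F l).
Proof.
move=> two0 l0.
(* The last two rows of [N] are eigenvectors of ad e1 in [fam (l ^+ 2)] for the eigenvalues [l] and
   [- l], scaled so that their bracket is [l *: e 4]; [M] is the inverse of [N]. *)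
pose M := frame (e F 1) (e F 2) (e F 3) (e F 4)
  (row6 0 0 0 0 (1 / 2) (- l)) (row6 0 0 0 0 (1 / (2 * l)) 1).
pose N := frame (e F 1) (e F 2) (e F 3) (e F 4)
  (row6 0 0 0 0 1 l) (row6 0 0 0 0 (- (1 / (2 * l))) (1 / 2)).
have mulM a b c d p q : row6 a b c d p q *m M =
    row6 a b c d (p / 2 + q / (2 * l)) (- l * p + q).
  by rewrite mul_frame !eE !(row6Z, row6D); congr row6; field; rewrite ?l0
    ?two0.
have mulN a b c d p q : row6 a b c d p q *m N =
    row6 a b c d (p - q / (2 * l)) (l * p + q / 2).
  by rewrite mul_frame !eE !(row6Z, row6D); congr row6; field; rewrite ?l0
    ?two0.
exists (fun x => x *m M); split.
- split=> [k u v|p x]; first by rewrite mulmxDl scalemxAl.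
  case: (row6P x) => [a [b [c [d [g [h ->]]]]]]; rewrite mulM.
  case: p => [/homogeneous_odd[? ? ? ?]|/homogeneous_even[? ?]]; subst.
    exact/homogeneous_odd.
  by apply/homogeneous_even; split; ring.
- exists (fun x => x *m N) => x; case: (row6P x) => [a [b [c [d [g [h ->]]]]]];
  by rewrite ?(mulM, mulN) ?(mulM, mulN); congr row6; field; rewrite ?l0 ?two0.
move=> x y; case: (row6P x) => [a [b [c [d [g [h ->]]]]]].
case: (row6P y) => [a' [b' [c' [d' [g' [h' ->]]]]]].
by rewrite fam_row6 !mulM g42_2_row6; congr row6; field; rewrite ?l0 ?two0.
Qed.

Lemma famX_smooth (C : numClosedFieldType) :
  smooth_deformation_to (fam (fpsX C)) (@g42_2 C) 0.
Proof.
split.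
  exists setT; split; [exact: openT|by []|by move=> t _; exact:
    famX_converges|].
  (* The trivial group suffices: by [fam_isomorphic_eq] distinct parameters already give
     non-isomorphic algebras. *)
  exists {perm 'I_1}, (TotalAction (to := fun (t : C) (g : {perm 'I_1}) => t)
    (fun t => erefl) (fun t g h => erefl)); split=> // t t' _ _ _ _.
  rewrite !specialize_famX; split=> [/fam_isomorphic_eq <-|[g ->]].
    by exists (1%g : {perm 'I_1}).
  by exists id; split=> //; exists id.
exists sqrtC; split; first exact: sqrtC_cvg0.
near=> t; rewrite specialize_famX -[X in fam X]sqrtCK.
apply: fam_isomorphic_g42_2; rewrite ?pnatr_eq0 // sqrtC_eq0.
by near: t; exact: nbhs_dnbhs_neq.
Unshelve. all: by end_near.
Qed.

(** * Frames of g[[t]] that reduce to the standard basis modulo t *)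

Section FrameReduction.
Variable C : fieldType.
Local Notation K := (fps C).
Local Notation V := 'rV[fps C]_(4 + 2).
Implicit Types (x y g : V).

Definition red n (F : 'M[K]_(n, 4 + 2)) : 'M[C]_(n, 4 + 2) := map_mx (@coef0 C)
  F.

(** The determinant is 1 modulo t, hence a unit, and the adjugate supplies the inverse; reducing
    [F *m G = 1%:M] shows that the inverse is also the identity modulo t. *)
Lemma red_unit (F : 'M[K]_(4 + 2)) : red F = 1%:M ->
  exists G, [/\ F *m G = 1%:M, G *m F = 1%:M & red G = 1%:M].
Proof.
move=> F1; have detF : coef0 (\det F) = 1.
  by have := det_map_mx (@coef0 C) F; rewrite -/(red F) F1 det1 => <-.
have [|d dE] := @fps_unit C (\det F); first by rewrite detF oner_eq0.
have FG : F *m (d *: \adj F) = 1%:M.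
  by rewrite -scalemxAr mul_mx_adj scale_scalar_mx mulrC dE.
exists (d *: \adj F); split=> //.
  by rewrite -scalemxAl mul_adj_mx scale_scalar_mx mulrC dE.
have := map_mxM (@coef0 C) F (d *: \adj F); rewrite FG -/(red F) F1 mul1mx /red
  => <-.
by rewrite map_mx1.
Qed.

Lemma homogeneous_both x : homogeneous false x -> homogeneous true x -> x = 0.
Proof.
case: (row6P x) => [a [b [c [d [p [q ->]]]]]].
by move=> /homogeneous_even[-> ->] /homogeneous_odd[-> -> -> ->]; exact: row60.
Qed.

Section Decomposition.
Variables g1 g2 g3 g4 g5 g6 : V.
Hypotheses (g1_even : homogeneous false g1) (g2_even : homogeneous false g2)
  (g3_even : homogeneous false g3) (g4_even : homogeneous false g4)
  (g5_odd : homogeneous true g5) (g6_odd : homogeneous true g6).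
Hypotheses (red_g1 : red g1 = e C 1) (red_g2 : red g2 = e C 2)
  (red_g3 : red g3 = e C 3) (red_g4 : red g4 = e C 4)
  (red_g5 : red g5 = e C 5) (red_g6 : red g6 = e C 6).
Let F := frame g1 g2 g3 g4 g5 g6.

Lemma red_frame : red F = 1%:M.
Proof.
rewrite -frame_e /red /F /frame map_frame ?rmorph0 // -!/(red _).
by rewrite red_g1 red_g2 red_g3 red_g4 red_g5 red_g6.
Qed.

Lemma frame_inj x : x *m F = 0 -> x = 0.
Proof.
have [G [FG _ _]] := red_unit red_frame.
by move=> xF; rewrite -[x]mulmx1 -FG mulmxA xF mul0mx.
Qed.

Lemma frame_split a b c d p q :
  row6 a b c d p q *m F = (a *: g1 + b *: g2 + c *: g3 + d *: g4) +
    (p *: g5 + q *: g6).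
Proof. by rewrite mul_frame !addrA. Qed.

Lemma frame_even_part a b c d :
  homogeneous false (a *: g1 + b *: g2 + c *: g3 + d *: g4).
Proof. by do !apply: homogeneousD; exact: homogeneousZ. Qed.

Lemma frame_odd_part p q : homogeneous true (p *: g5 + q *: g6).
Proof. by apply: homogeneousD; exact: homogeneousZ. Qed.

Lemma frame_decomp x : exists a b c d p q,
  x = (a *: g1 + b *: g2 + c *: g3 + d *: g4) + (p *: g5 + q *: g6).
Proof.
have [G [_ GF _]] := red_unit red_frame.
case: (row6P (x *m G)) => [a [b [c [d [p [q E]]]]]].
exists a, b, c, d, p, q.
by rewrite -frame_split -E -mulmxA GF mulmx1.
Qed.

(** The component of the wrong parity is both even and odd, hence zero, and its coordinates vanish
    because the frame is independent. *)
Lemma frame_homogeneous p x : homogeneous p (x *m F) -> homogeneous p x.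
Proof.
case: (row6P x) => [a [b [c [d [u [v ->]]]]]]; rewrite frame_split.
case: p => h; [apply/homogeneous_odd|apply/homogeneous_even].
  have /frame_inj : row6 a b c d 0 0 *m F = 0.
    apply: homogeneous_both; rewrite frame_split !scale0r !addr0.
      exact: frame_even_part.
    rewrite -[X in homogeneous _ X](addrK (u *: g5 + v *: g6)).
    by apply: homogeneousD => //; apply/homogeneousN/frame_odd_part.
  by rewrite -row60 => /row6_inj[[-> -> ->] [->]].
have /frame_inj : row6 0 0 0 0 u v *m F = 0.
  apply: homogeneous_both; rewrite frame_split !scale0r !add0r; last first.
    exact: frame_odd_part.
  rewrite -[X in homogeneous _ X](addKr (a *: g1 + b *: g2 + c *: g3 + d *:
    g4)).
  by apply: homogeneousD => //; apply/homogeneousN/frame_even_part.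
by rewrite -row60 => /row6_inj[_ [_ -> ->]].
Qed.

Lemma frame_decomp_even x : homogeneous false x -> exists a b c d,
  x = a *: g1 + b *: g2 + c *: g3 + d *: g4.
Proof.
have [a [b [c [d [p [q ->]]]]]] := frame_decomp x.
rewrite -frame_split => /frame_homogeneous/homogeneous_even[-> ->].
by exists a, b, c, d; rewrite frame_split !scale0r !addr0.
Qed.

Lemma frame_decomp_odd x : homogeneous true x -> exists p q,
  x = p *: g5 + q *: g6.
Proof.
have [a [b [c [d [p [q ->]]]]]] := frame_decomp x.
rewrite -frame_split => /frame_homogeneous/homogeneous_odd[-> -> -> ->].
by exists p, q; rewrite frame_split !scale0r !add0r.
Qed.

Lemma frame_comb_inj a b c d p q a' b' c' d' p' q' :
  a *: g1 + b *: g2 + c *: g3 + d *: g4 + (p *: g5 + q *: g6) =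
  a' *: g1 + b' *: g2 + c' *: g3 + d' *: g4 + (p' *: g5 + q' *: g6) ->
  [/\ a = a', b = b' & c = c'] /\ [/\ d = d', p = p' & q = q'].
Proof.
rewrite -!frame_split => /eqP; rewrite -subr_eq0 -mulmxBl => /eqP/frame_inj/eqP.
by rewrite subr_eq0 => /eqP/row6_inj.
Qed.

Lemma red_comb a b c d p q :
  red (a *: g1 + b *: g2 + c *: g3 + d *: g4 + (p *: g5 + q *: g6)) =
  row6 (coef0 a) (coef0 b) (coef0 c) (coef0 d) (coef0 p) (coef0 q).
Proof.
by rewrite -frame_split /red map_mxM -!/(red _) red_frame mulmx1 /red map_row6.
Qed.

(** Passing to coordinates in the frame is the equivalence: it is even because the frame vectors are
    homogeneous, and it is the identity modulo t because the frame is. *)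
Lemma frame_equivalent br (s : K) :
    (forall x y, br (x *m F) (y *m F) = fam s x y *m F) ->
  equivalent br (fam s).
Proof.
move=> brF; have [G [FG GF G1]] := red_unit red_frame.
have GK x : x *m G *m F = x by rewrite -mulmxA GF mulmx1.
exists (fun x => x *m G); split.
- split=> [k x y|p x px]; first by rewrite mulmxDl scalemxAl.
  by apply: frame_homogeneous; rewrite GK.
- move=> x; rewrite -[LHS]/(red (map_mx (@fpsC C) x *m G)) /red map_mxM.
  rewrite -!/(red _) G1 mulmx1.
  by apply/rowP => i; rewrite !mxE.
by move=> x y; rewrite -[in LHS](GK x) -[in LHS](GK y) brF -mulmxA FG mulmx1.
Qed.

End Decomposition.
End FrameReduction.

(** * Consequences of the Jacobi identity and invariance for the vectors generated by [f1] and
    [f6] *)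

Section OddPart.
Variables (K : comNzRingType) (m n : nat).
Local Notation V := 'rV[K]_(m + n).
Implicit Types x y z : V.
Variables (br : V -> V -> V) (B : V -> V -> K) (h k : K) (s : K) (f1 f6 : V).
Hypotheses (h2 : 2 * h = 1) (k3 : 3 * k = 1) (br_lie : lie_superalgebra br)
  (B_form : metric_form br B).
Hypotheses (f1_even : homogeneous false f1) (f6_odd : homogeneous true f6).
Let f5 := br f1 f6.
Let f4 := br f6 f6.
Let r := br f5 f6.
Hypothesis br15 : br f1 f5 = s *: f6.

Let f5_odd : homogeneous true f5 := br_hom br_lie f1_even f6_odd.
Let f4_even : homogeneous false f4 := br_hom br_lie f6_odd f6_odd.
Let r_even : homogeneous false r := br_hom br_lie f5_odd f6_odd.
Let inv x y z : B (br x y) z = B x (br y z) := form_invariant B_form x y z.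

(** The Jacobi identity for three copies of [f6] says that three times this bracket is zero. *)
Lemma br64 : br f6 f4 = 0.
Proof.
have := jacobi_odd br_lie f6_odd f6_odd f6_odd; rewrite -/f4.
have -> : br f4 f6 = - br f6 f4 by rewrite (skew_even br_lie f4_even f6_odd)
  opprK.
move=> /eqP; rewrite -subr_eq0 opprB opprK addrA => /eqP j.
rewrite -[br f6 f4]scale1r -k3 mulrC -scalerA scaler_nat !mulrS mulr0n addr0
  addrA.
by rewrite j scaler0.
Qed.

Lemma form15 : B f5 f5 = 0. Proof. exact: (form_odd_self h2 B_form f5_odd). Qed.

Lemma form44 : B f4 f4 = 0.
Proof. by rewrite [LHS](inv f6 f6 f4) br64 (form0r B_form). Qed.

Lemma form14 : B f1 f4 = B f5 f6.
Proof. by rewrite -inv. Qed.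

Lemma br14 : br f1 f4 = r + r.
Proof.
rewrite (jacobi_even br_lie f1_even f6_odd f6_odd) -/f5.
by rewrite (skew_odd br_lie f5_odd f6_odd).
Qed.

Lemma br1_br55 : br f1 (br f5 f5) = s *: (r + r).
Proof.
rewrite (jacobi_even br_lie f1_even f5_odd f5_odd) br15 (brZl br_lie) (brZr
  br_lie).
by rewrite (skew_odd br_lie f5_odd f6_odd) scalerDr.
Qed.

Lemma br1_br56 : br f1 r = s *: f4 + br f5 f5.
Proof.
by rewrite (jacobi_even br_lie f1_even f5_odd f6_odd) br15 (brZl br_lie).
Qed.

(** Here [f1, r] = s f4 + [f5, f5], and ad f1 sends [f4] to 2r and [f5, f5] to 2sr. *)
Lemma br11_br56 : br f1 (br f1 r) = (4 * s) *: r.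
Proof.
rewrite br1_br56 (brDr br_lie) (brZr br_lie) br14 br1_br55 -!scalerDr.
by rewrite mulrC -scalerA scaler_nat !mulrS mulr0n addr0 !addrA.
Qed.

Lemma form_br56_1 : B r f1 = 0.
Proof.
rewrite inv (skew_even br_lie f1_even f6_odd) -scaleN1r (formZr B_form) form15.
exact: mulr0.
Qed.

Lemma form_br56_4 : B r f4 = 0.
Proof. by rewrite inv br64 (form0r B_form). Qed.

Hypothesis r0 : r = 0.

Lemma br55 : br f5 f5 = - s *: f4.
Proof.
have := br1_br56; rewrite r0 (br0r br_lie) => /eqP.
by rewrite eq_sym addrC addr_eq0 scaleNr => /eqP.
Qed.

Lemma br14_eq0 : br f1 f4 = 0.
Proof. by rewrite br14 r0 addr0. Qed.

Lemma br54 : br f5 f4 = 0.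
Proof.
rewrite (jacobi_odd br_lie f5_odd f6_odd f6_odd) -/r r0.
by rewrite (br0l br_lie) (br0r br_lie) subr0.
Qed.

(** By invariance the value is B(x, r). Since [f5] is isotropic, this will exclude an [f6] component
    from the bracket of an even [x] with [f6]. *)
Lemma form_br6_5 x : B (br x f6) f5 = 0.
Proof. by rewrite inv (skew_odd br_lie f5_odd f6_odd) -/r r0 (form0r B_form).
  Qed.

Section Centralizer.
Variable x : V.
Hypotheses (x_even : homogeneous false x) (brx6 : br x f6 = 0).

Lemma centralizer_br4 : br x f4 = 0.
Proof.
rewrite (jacobi_even br_lie x_even f6_odd f6_odd) brx6.
by rewrite (br0l br_lie) (br0r br_lie) addr0.
Qed.

Lemma centralizer_form4 : B x f4 = 0.
Proof. by rewrite -inv brx6 (form0l B_form). Qed.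

(** Once [f5] and [f6] are known to span the odd part, these two equations force [x, f5] = 0 by
    non-degeneracy. *)
Lemma centralizer_form5 : B (br x f5) f6 = 0 /\ B (br x f5) f5 = 0.
Proof.
rewrite !inv -/r r0 br55 (formZr B_form) centralizer_form4 mulr0.
by rewrite (form0r B_form).
Qed.

End Centralizer.
End OddPart.

(** * Diagonalizing ad f1 on the span of [f2] and [f3] modulo [f4], and rescaling *)

Section Normalization.
Variables (K : comNzRingType).
Local Notation V := 'rV[K]_(4 + 2).
Variables (br : V -> V -> V) (h s p q r q' r' ga m mi k : K).
Variables (f1 f2 f3 f4 f5 f6 : V).
Hypotheses (h2 : 2 * h = 1) (br_lie : lie_superalgebra br).
Hypotheses (f1_even : homogeneous false f1) (f2_even : homogeneous false f2)
  (f3_even : homogeneous false f3) (f4_even : homogeneous false f4)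
  (f5_odd : homogeneous true f5) (f6_odd : homogeneous true f6).
Hypotheses (br12 : br f1 f2 = p *: f2 + q *: f3 + r *: f4)
  (br13 : br f1 f3 = q' *: f2 - p *: f3 + r' *: f4)
  (br23 : br f2 f3 = ga *: f4) (br14 : br f1 f4 = 0).
Hypotheses (br24 : br f2 f4 = 0) (br25 : br f2 f5 = 0) (br26 : br f2 f6 = 0).
Hypotheses (br34 : br f3 f4 = 0) (br35 : br f3 f5 = 0) (br36 : br f3 f6 = 0).
Hypotheses (br45 : br f4 f5 = 0) (br46 : br f4 f6 = 0).
Hypotheses (br15 : br f1 f5 = s *: f6) (br16 : br f1 f6 = f5).
Hypotheses (br55 : br f5 f5 = - s *: f4) (br56 : br f5 f6 = 0)
  (br66 : br f6 f6 = f4).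
Hypotheses (m2 : m ^+ 2 = p ^+ 2 + q * q') (mV : m * mi = 1)
  (kE : k * m * (m + p) * ga = 1).

Let comb a b c := a *: f2 + b *: f3 + c *: f4.

Lemma comb_even a b c : homogeneous false (comb a b c).
Proof. by move=> i i0; rewrite !mxE f2_even // f3_even // f4_even // !mulr0
  !addr0. Qed.

Let brE := (brDl br_lie, brDr br_lie, brZl br_lie, brZr br_lie).

Lemma br1_comb a b c :
  br f1 (comb a b c) = comb (a * p + b * q') (a * q - b * p) (a * r + b * r').
Proof.
by rewrite !brE br12 br13 br14; apply/rowP => i; rewrite !mxE; ring.
Qed.

Lemma br_comb a b c a' b' c' :
  br (comb a b c) (comb a' b' c') = ((a * b' - b * a') * ga) *: f4.
Proof.
have br32 := skew_even br_lie f2_even f3_even.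
have br42 := skew_even br_lie f2_even f4_even.
have br43 := skew_even br_lie f3_even f4_even.
rewrite !brE br32 br42 br43 br24 br34 br23 !(br_self h2 br_lie) //.
by apply/rowP => i; rewrite !mxE; ring.
Qed.

Lemma br_comb0 a b c y : br f2 y = 0 -> br f3 y = 0 -> br f4 y = 0 ->
  br (comb a b c) y = 0.
Proof. by rewrite !brE => -> -> ->; rewrite !scaler0 !addr0. Qed.

(* The vectors (m + p, q) and (- q', m + p) are eigenvectors of ad f1 modulo
   f4, for the eigenvalues m and - m; the f4 components make them exact. *)
Lemma normalized_frame_morphism :
  let F := frame (mi *: f1)
    (comb (k * (m + p)) (k * q) (k * mi * ((m + p) * r + q * r')))
    (comb (- (h * q')) (h * (m + p)) (h * mi * (q' * r - (m + p) * r')))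
    f4 (mi *: f5) f6 in
  forall x y, br (x *m F) (y *m F) = fam (s * mi ^+ 2) x y *m F.
Proof.
have f44 : br f4 f4 = 0 by rewrite (br_self h2 br_lie).
apply: (frame_morphism h2 br_lie).
- by split=> //; [exact: homogeneousZ | exact: comb_even | exact: comb_even].

- exact: homogeneousZ.
- by [].
- split.
  + rewrite (brZl br_lie) br1_comb; apply/rowP => i; rewrite !mxE.
    have -> : mi * (((k * (m + p)) * p + (k * q) * q') * f2 0 i +
        ((k * (m + p)) * q - (k * q) * p) * f3 0 i +
        ((k * (m + p)) * r + (k * q) * r') * f4 0 i) =
      (k * mi * ((m + p) * p + q * q')) * f2 0 i + (k * (m * mi) * q) * f3 0 i +
        (k * mi * ((m + p) * r + q * r')) * f4 0 i by ring.
    (* This is the characteristic equation of the traceless matrix of ad f1, in the form [m2]. *)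
    have -> : (m + p) * p + q * q' = m * (m + p) by ring: m2.
    by rewrite -[k * mi * _]mulrA [mi * _]mulrA [mi * m]mulrC mV !mulr1 mul1r.
  + rewrite (brZl br_lie) br1_comb; apply/rowP => i; rewrite !mxE.
    have -> : mi * (((- (h * q')) * p + (h * (m + p)) * q') * f2 0 i +
        ((- (h * q')) * q - (h * (m + p)) * p) * f3 0 i +
        ((- (h * q')) * r + (h * (m + p)) * r') * f4 0 i) =
      (h * (m * mi) * q') * f2 0 i - (h * mi * ((m + p) * p + q * q')) * f3 0 i
        -
        (h * mi * (q' * r - (m + p) * r')) * f4 0 i by ring.
    have -> : (m + p) * p + q * q' = m * (m + p) by ring: m2.
    have -> : h * mi * (m * (m + p)) = h * (m * mi) * (m + p) by ring.
    by rewrite mV !mulr1; ring.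
  rewrite br_comb -[RHS]scale1r; congr (_ *: _).
  (* The bracket is the determinant of the two coordinate pairs times [ga]; the scalar [k] is the
     one that makes it equal to 1. *)
  have -> : (k * (m + p) * (h * (m + p)) - k * q * - (h * q')) * ga =
    (h * k * ga) * ((m + p) ^+ 2 + q * q') by ring.
  have -> : (m + p) ^+ 2 + q * q' = 2 * m * (m + p) by ring: m2.
  transitivity ((k * m * (m + p) * ga) * (2 * h)); first by ring.
  by rewrite kE h2 mulr1.
- by split; rewrite ?br_comb0 // (brZl br_lie) br14 scaler0.
(* Dividing [f1] by [m] forces [f5] to be divided by [m] as well, while [f6] is kept; so [s] is
   divided by [m ^+ 2]. *)
- split; rewrite ?(brZr br_lie) ?br_comb0 ?br45 ?scaler0 //.
  by rewrite (brZl br_lie) br15 !scalerA; congr (_ *: _); ring.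
- by split; rewrite ?br_comb0 // (brZl br_lie) br16.
split=> //; rewrite ?(brZl br_lie) ?(brZr br_lie) ?br55 ?br56 ?scaler0 //.
by rewrite !scalerA; congr (_ *: _); ring.
Qed.

End Normalization.

Lemma bilinear_delta (K : comNzRingType) (m n : nat)
    (br : 'rV[K]_(m + n) -> 'rV[K]_(m + n) -> 'rV[K]_(m + n)) x y :
  even_super_skew br -> br x y =
    \sum_i \sum_j (x 0 i * y 0 j) *: br (delta_mx 0 i) (delta_mx 0 j).
Proof.
case=> linl linr _ _; rewrite [x in LHS]row_sum_delta [y in LHS]row_sum_delta.
rewrite (linear_sum_scale _ _ _ (linl _)) //; apply: eq_bigr => i _.
rewrite linear_sum_scale // scaler_sumr.
by apply: eq_bigr => j _; rewrite scalerA.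
Qed.

(** * Leading coefficients of brackets and of the form *)

Section Reduction.
Variable C : numFieldType.
Local Notation K := (fps C).
Local Notation V := 'rV[fps C]_(4 + 2).
Implicit Types x y z : V.
Variables (br : V -> V -> V) (B : V -> V -> K).
Hypotheses (br_lie : lie_superalgebra br) (B_form : metric_form br B)
  (br_def : forall x y : 'rV[C]_(4 + 2), deformation_term br 0 x y = @g42_1 C x
    y).

Definition row_coef n x : 'rV[C]_(4 + 2) := map_mx (fun f => coefs f n) x.

Lemma row_coef_eq0 x : (forall n, row_coef n x = 0) -> x = 0.
Proof.
move=> x0; apply/rowP => i; apply: fpsP => n.
by have /rowP/(_ i) := x0 n; rewrite !mxE coefs0.
Qed.

Lemma red_e k : red (e K k) = e C k.
Proof. by apply/rowP => i; rewrite !mxE rmorph_nat. Qed.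

(** When t^n divides [y], the coefficient of t^n in a product of coordinates and structure constants
    only sees the leading term of [y] and everything else at t = 0, where the bracket is [g42_1]. *)
Lemma row_coef_br n x y : (forall i, (i < n)%N -> row_coef i y = 0) ->
  row_coef n (br x y) = fam 0 (red x) (row_coef n y).
Proof.
move=> y0; have [fam0 _] := fam_lie_superalgebra (0 : C).
rewrite (bilinear_delta x y br_lie.1) [RHS](bilinear_delta _ _ fam0).
apply/rowP => k; rewrite mxE !summxE coefs_sum; apply: eq_bigr => i _.
rewrite !summxE coefs_sum; apply: eq_bigr => j _; rewrite !mxE.
have -> : fam 0 (delta_mx 0 i) (delta_mx 0 j) 0 k =
    coef0 (br (delta_mx 0 i) (delta_mx 0 j) 0 k).
  rewrite -g42_1E -br_def /deformation_term mxE /coef0.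
  by rewrite !map_delta_mx.
rewrite -mulrA mulrCA coefsM_low => [|l ln].
  by rewrite /coef0 coefsM0 mulrA [coefs (y 0 j) n * _]mulrC.
by have /rowP/(_ j) := y0 l ln; rewrite !mxE.
Qed.

Lemma red_br x y : red (br x y) = fam 0 (red x) (red y).
Proof. exact: (@row_coef_br 0). Qed.

Lemma coefs_form n x y a b c d : (forall i, (i < n)%N -> row_coef i x = 0) ->
  row_coef n x = row6 a b c d 0 0 ->
  coefs (B x y) n = a * coef0 (B (e K 1) y) + b * coef0 (B (e K 2) y) +
    c * coef0 (B (e K 3) y) + d * coef0 (B (e K 4) y).
Proof.
move=> x0 xn.
have xE i : row_coef i x = row6 (coefs (x 0 (inord 0%N)) i) (coefs (x 0 (inord
  1%N)) i)
    (coefs (x 0 (inord 2)) i) (coefs (x 0 (inord 3)) i)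
    (coefs (x 0 (inord 4)) i) (coefs (x 0 (inord 5)) i).
  case: (row6P x) => [a' [b' [c' [d' [p' [q' ->]]]]]].
  by rewrite /row_coef map_row6 !mxE !inordK.
have xsum : x = x 0 (inord 0%N) *: e K 1 + x 0 (inord 1%N) *: e K 2 +
    x 0 (inord 2) *: e K 3 + x 0 (inord 3) *: e K 4 +
    x 0 (inord 4) *: e K 5 + x 0 (inord 5) *: e K 6.
  case: (row6P x) => [a' [b' [c' [d' [p' [q' ->]]]]]].
  rewrite !mxE !inordK //= !eE !row6Z !row6D.
  by congr row6; rewrite ?mulr0 ?mulr1 ?addr0 ?add0r.
have [[ea eb ec] [ed ep eq]] := row6_inj (etrans (esym (xE n)) xn).
rewrite xsum !(formDl B_form) !(formZl B_form) !coefsD !coefsM_low ?ea ?eb ?ec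
  ?ed ?ep ?eq.
  by rewrite !mul0r !addr0.
all: by move=> i lt_in; have := x0 i lt_in; rewrite xE -row60 =>
  /row6_inj[[? ? ?] [? ? ?]].
Qed.

(** Let [x] represent the sixth coordinate through the form. Pairing it with [f6] leaves only its
    [f5] component [p], by parity and because [f6] is isotropic, so [p] is the inverse. *)
Lemma form_nondegenerate_odd f5 f6 : homogeneous true f5 -> homogeneous true f6
  ->
  (forall z, exists a p q, homogeneous false a /\ z = a + (p *: f5 + q *: f6))
    ->
  f6 = e K 6 -> exists wi, B f5 f6 * wi = 1.
Proof.
move=> o5 o6 dec f6E.
have [|x [xE _]] := form_nondegenerate B_form (f := fun y => y 0 (inord 5)).
  by move=> k u v; rewrite !mxE.
have [a [p [q [a0 xdec]]]] := dec x; exists p.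
have h2 : (2 : K) * fpsC (2^-1) = 1.
  have -> : (2 : K) = fpsC 2 by rewrite rmorph_nat.
  by rewrite -rmorphM mulfV ?rmorph1 // pnatr_eq0.
have := xE f6; rewrite xdec !(formDl B_form) !(formZl B_form).
rewrite (form_even B_form a0 o6) // (form_odd_self h2 B_form o6) mulr0 addr0
  add0r.
by rewrite mulrC => ->; rewrite f6E eE mxE inordK.
Qed.

End Reduction.

(* p, q, q', p' are the entries of ad f1 on the span of f2 and f3 modulo
   f4, and al, be the coordinates of [f2, f3] there. *)
Lemma eigen_determinant (K : comNzRingType) (p p' q q' al be u : K) :
    u * (p * p' - q * q') = 1 ->
    al * p + be * q' = (p + p') * al -> al * q + be * p' = (p + p') * be ->
  al = 0 /\ be = 0.
Proof.
move=> uE E1 E2.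
(* The two equations become a homogeneous system in [al] and [be] whose determinant is, up to sign,
   the unit p p' - q q'. *)
have {}E1 : be * q' = p' * al by apply: (addrI (al * p)); rewrite E1; ring.
have {}E2 : al * q = p * be by apply: (addIr (be * p')); rewrite E2; ring.
split.
  have -> : al = u * (p * (p' * al) - al * q * q') by rewrite -[LHS]mul1r -uE;
    ring.
  by rewrite -E1 E2; ring.
have -> : be = u * (p * be * p' - q * (be * q')) by rewrite -[LHS]mul1r -uE;
  ring.
by rewrite E1 -E2; ring.
Qed.

(* The vanishing terms put both sides in the shape of frame_comb_inj. *)
Lemma jacobi_comb (K : comNzRingType) (m n : nat)
    (br : 'rV[K]_(m + n) -> 'rV[K]_(m + n) -> 'rV[K]_(m + n)) (h : K)
    f1 f2 f3 f4 (p q t q' p' t' al be ga : K) :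
    2 * h = 1 -> lie_superalgebra br ->
    homogeneous false f1 -> homogeneous false f2 -> homogeneous false f3 ->
    homogeneous false f4 ->
    br f1 f2 = p *: f2 + q *: f3 + t *: f4 ->
    br f1 f3 = q' *: f2 + p' *: f3 + t' *: f4 ->
    br f2 f3 = al *: f2 + be *: f3 + ga *: f4 ->
    br f1 f4 = 0 -> br f2 f4 = 0 -> br f3 f4 = 0 ->
  forall f5 f6,
    0 *: f1 + (al * p + be * q') *: f2 + (al * q + be * p') *: f3 +
      (al * t + be * t') *: f4 + (0 *: f5 + 0 *: f6) =
    0 *: f1 + ((p + p') * al) *: f2 + ((p + p') * be) *: f3 +
      ((p + p') * ga) *: f4 + (0 *: f5 + 0 *: f6).
Proof.
move=> h2 br_lie f1_even f2_even f3_even f4_even br12 br13 br23 br14 br24 br34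
  f5 f6.
have br43 : br f4 f3 = 0 by rewrite (skew_even br_lie f3_even f4_even) br34
  oppr0.
have := jacobi_even br_lie f1_even f2_even f3_even.
rewrite br12 br13 {1}br23 !(brDl br_lie, brDr br_lie, brZl br_lie, brZr br_lie).
rewrite br12 br13 br14 br24 br43 !(br_self h2 br_lie) // br23 => J.
apply/rowP => i; move: J => /rowP/(_ i); rewrite !mxE => J.
have jl : al * (p * f2 0 i + q * f3 0 i + t * f4 0 i) +
    be * (q' * f2 0 i + p' * f3 0 i + t' * f4 0 i) + ga * 0 =
    0 * f1 0 i + (al * p + be * q') * f2 0 i + (al * q + be * p') * f3 0 i +
      (al * t + be * t') * f4 0 i + (0 * f5 0 i + 0 * f6 0 i) by ring.
by rewrite -jl J; ring.
Qed.

Section Coef0.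
Variable C : comNzRingType.
Implicit Types f g : fps C.

Lemma coef0D f g : coef0 (f + g) = coef0 f + coef0 g. Proof. by []. Qed.

Lemma coef0N f : coef0 (- f) = - coef0 f. Proof. by []. Qed.

Lemma coef0M f g : coef0 (f * g) = coef0 f * coef0 g. Proof. exact: coefsM0.
  Qed.

Lemma coef0_0 : coef0 (0 : fps C) = 0. Proof. exact: coefs0. Qed.

End Coef0.

(** * Every metric deformation of [g42_1] is equivalent to some [fam s] *)

Section Classification.
Variable C : numFieldType.
Local Notation K := (fps C).
Local Notation V := 'rV[fps C]_(4 + 2).
Implicit Types x y z : V.
Variables (br : V -> V -> V) (B : V -> V -> K).
Hypotheses (br_lie : lie_superalgebra br) (B_form : metric_form br B)
  (br_def : forall x y : 'rV[C]_(4 + 2), deformation_term br 0 x y = @g42_1 C x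
    y).

Lemma fps_natV n : (0 < n)%N -> (n%:R : K) * fpsC (n%:R^-1) = 1.
Proof.
move=> n0; rewrite -(rmorph_nat (@fpsC C)) -rmorphM mulfV ?rmorph1 //.
by rewrite pnatr_eq0 -lt0n.
Qed.

Let h2 : (2 : K) * fpsC (2^-1) = 1 := fps_natV (isT : 0 < 2)%N.
Let k3 : (3 : K) * fpsC (3^-1) = 1 := fps_natV (isT : 0 < 3)%N.

Let f1 : V := e K 1.
Let f6 : V := e K 6.
Let f5 := br f1 f6.
Let f4 := br f6 f6.

Let f1_even : homogeneous false f1.
Proof. by rewrite /f1 eE; apply/homogeneous_even. Qed.
Let f6_odd : homogeneous true f6.
Proof. by rewrite /f6 eE; apply/homogeneous_odd. Qed.
Let f5_odd : homogeneous true f5 := br_hom br_lie f1_even f6_odd.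
Let f4_even : homogeneous false f4 := br_hom br_lie f6_odd f6_odd.

Let red1 : red f1 = e C 1. Proof. exact: red_e. Qed.
Let red6 : red f6 = e C 6. Proof. exact: red_e. Qed.
Let red5 : red f5 = e C 5.
Proof.
rewrite (red_br br_lie br_def) red1 red6 !eE fam_row6.
by congr row6; do ?rewrite (mul0r, mulr0, mulr1, subr0, addr0, add0r, oppr0).
Qed.
Let red4 : red f4 = e C 4.
Proof.
rewrite (red_br br_lie br_def) red6 !eE fam_row6.
by congr row6; do ?rewrite (mul0r, mulr0, mulr1, subr0, addr0, add0r, oppr0).
Qed.

Let e_even k : (0 < k < 5)%N -> homogeneous false (e K k).
Proof.
by case: k => [|[|[|[|[|]]]]] // _; rewrite eE; apply/homogeneous_even.
Qed.

Let decomp x : exists y p q, homogeneous false y /\ x = y + (p *: f5 + q *: f6).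
Proof.
have := frame_decomp red1 (red_e C 2) (red_e C 3) red4 red5 red6 x.
move=> [a [b [c [d [p [q ->]]]]]]; do 3!eexists; split; last by [].
by apply: frame_even_part => //; exact: e_even.
Qed.

Let decomp_odd x : homogeneous true x -> exists p q, x = p *: f5 + q *: f6.
Proof.
by apply: (frame_decomp_odd f1_even (e_even (isT : 0 < 2 < 5)%N)
  (e_even (isT : 0 < 3 < 5)%N) f4_even f5_odd f6_odd red1 (red_e C 2)
  (red_e C 3) red4 red5 red6).
Qed.

Let w := B f5 f6.

Let w_unit : exists wi, w * wi = 1.
Proof. exact: (form_nondegenerate_odd B_form f5_odd f6_odd decomp). Qed.

Let w_eq0 a : a * w = 0 -> a = 0.
Proof.
by have [wi wE] := w_unit => aw; rewrite -[a]mulr1 -wE mulrA aw mul0r.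
Qed.

Let form65 : B f6 f5 = - w.
Proof. exact: (form_skew B_form f5_odd f6_odd). Qed.
Let form55 : B f5 f5 = 0. Proof. exact: (form_odd_self h2 B_form f5_odd). Qed.
Let form66 : B f6 f6 = 0. Proof. exact: (form_odd_self h2 B_form f6_odd). Qed.

(** Invariance gives B([f1, f5], f6) = - B(f5, f5) = 0, which removes the [f5] component; [s]
    vanishes modulo t because [e1, e5] = 0 in [g42_1]. *)
Let br15_ex : exists2 s, br f1 f5 = s *: f6 & coef0 s = 0.
Proof.
have [p [q E]] := decomp_odd (br_hom br_lie f1_even f5_odd).
have p0 : p = 0.
  apply: w_eq0; have : B (br f1 f5) f6 = 0.
    rewrite (_ : br f1 f5 = - br f5 f1); last first.
      by rewrite (skew_even br_lie f1_even f5_odd) opprK.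
    by rewrite -scaleN1r (formZl B_form) (form_invariant B_form) form55 mulr0.
  by rewrite E (formDl B_form) !(formZl B_form) form66 mulr0 addr0.
rewrite p0 scale0r add0r in E; exists q => //.
have := red_br br_lie br_def f1 f5; rewrite red1 red5 E /red map_mxZ -/(red f6)
  red6.
rewrite !eE fam_row6 row6Z => /row6_inj[_ [_ _]].
by rewrite mulr1 => E0; rewrite -[LHS]/(coef0 q) [LHS]E0 mul0r.
Qed.

Section Family.
Variable s : K.
Hypotheses (br15 : br f1 f5 = s *: f6) (s0 : coef0 s = 0).
Let r := br f5 f6.

Let coef0_w : coef0 w != 0.
Proof.
have [wi /(congr1 (@coef0 C))] := w_unit; rewrite /coef0 coefsM0 => E.
by apply/eqP => z; move/eqP: E; rewrite z mul0r eq_sym oner_eq0.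
Qed.

Let form_red x y z : red x = red y -> homogeneous false x -> homogeneous false
  y ->
  coef0 (B x z) = coef0 (B y z).
Proof.
move=> xy x0 y0; have : homogeneous false (red x).
  by apply: homogeneous_map.
case: (row6P (red x)) => [a [b [c [d [p [q xE]]]]]].
rewrite xE => /homogeneous_even[p0 q0]; rewrite p0 q0 in xE.
rewrite /coef0 (@coefs_form _ br B B_form 0 x z a b c d) //.
by rewrite (@coefs_form _ br B B_form 0 y z a b c d) // -xE xy.
Qed.

Let r0 : r = 0.
Proof.
have r_even : homogeneous false r := br_hom br_lie f5_odd f6_odd.
have row_coef_br1 n : (forall i, (i < n)%N -> row_coef i r = 0) -> row_coef n
  (br f1 r) = fam 0 (e C 1) (row_coef n r).
  by move=> /(row_coef_br br_lie br_def f1); rewrite red1.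
apply: row_coef_eq0; elim/ltn_ind => n IHn.
(* The bracket equals 4sr; as t divides [s] and t^n divides [r], its coefficient of degree [n] is
   zero. *)
have cf0 : row_coef n (br f1 (br f1 r)) = 0.
  rewrite (br11_br56 br_lie f1_even f6_odd br15) -/r.
  apply/rowP => k; rewrite !mxE mulrC coefsM_low; last first.
    by move=> i lt_in; have /rowP/(_ k) := IHn i lt_in; rewrite !mxE.
  by rewrite /coef0 coefsM0 -!/(coef0 _) s0 mulr0 mulr0.
have := row_coef_br br_lie br_def f1 (n := n) (y := br f1 r).
rewrite cf0 row_coef_br1 // red1 => E.
have {E} : 0 = fam 0 (e C 1) (fam 0 (e C 1) (row_coef n r)).
  apply: E => i lt_in; rewrite row_coef_br1 ?IHn //; last first.
    by move=> j ji; apply: IHn; exact: ltn_trans lt_in.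
  exact: (br0r (fam_lie_superalgebra (0 : C))).
have : homogeneous false (row_coef n r) by apply: homogeneous_map => //; exact:
  coefs0.
case: (row6P (row_coef n r)) => [a [b [c [d [p [q xE]]]]]].
rewrite xE => /homogeneous_even[p0 q0].
(* At t = 0 the square of ad e1 is the identity on [e 2] and [e 3], so these two coordinates vanish;
   the form must exclude [e 1] and [e 4]. *)
rewrite p0 q0 eE !fam_row6 -row60 => /row6_inj[[_ b0 c0] _].
have {}b0 : b = 0 by apply: (etrans _ (esym b0)); ring.
have {}c0 : c = 0 by apply: (etrans _ (esym c0)); ring.
rewrite b0 c0 p0 q0 in xE.
have r_form y := coefs_form B_form y IHn xE.
have w14 : coef0 (B f1 f4) = coef0 w by rewrite (form14 f1 f6 B_form).
(* Modulo t, [f4] is isotropic and pairs with [f1] to the nonzero constant of [w]. So the pairing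
   with [f4] isolates [a], and then the pairing with [f1] isolates [d]. *)
have a0 : a = 0.
  have := r_form f4; rewrite (form_br56_4 f1 k3 br_lie B_form f6_odd) coefs0.
  rewrite -/f1 w14 (@form_red (e K 4) f4) ?red_e ?red4 //; last exact: e_even.
  rewrite (form44 k3 br_lie B_form f6_odd) rmorph0 mulr0 !mul0r !addr0.
  by move/esym/eqP; rewrite mulf_eq0 (negbTE coef0_w) orbF => /eqP.
have d0 : d = 0.
  have := r_form f1; rewrite (form_br56_1 h2 br_lie B_form f1_even f6_odd)
    coefs0.
  rewrite a0 !mul0r !add0r (@form_red (e K 4) f4) ?red_e ?red4 //; last exact:
    e_even.
  rewrite (form_sym B_form f1_even f4_even) w14.
  by move/esym/eqP; rewrite mulf_eq0 (negbTE coef0_w) orbF => /eqP.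
by rewrite a0 b0 c0 d0 row60.
Qed.

Let br55E : br f5 f5 = - s *: f4 := br55 br_lie f1_even f6_odd br15 r0.
Let br14E : br f1 f4 = 0 := br14_eq0 br_lie f1_even f6_odd r0.
Let br54E : br f5 f4 = 0 := br54 br_lie f1_even f6_odd r0.
Let br64E : br f6 f4 = 0 := br64 k3 br_lie f6_odd.

Let odd_eq0 x : homogeneous true x -> B x f5 = 0 -> B x f6 = 0 -> x = 0.
Proof.
move=> /decomp_odd[p [q ->]]; rewrite !(formDl B_form) !(formZl B_form).
rewrite form55 form66 form65 -/w !mulr0 add0r addr0 mulrN => /eqP.
by rewrite oppr_eq0 => /eqP/w_eq0-> /w_eq0->; rewrite !scale0r addr0.
Qed.

(* ad x f6 is a multiple of f5 = ad f1 f6, so it can be killed by adding a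
   multiple of f1. *)
Lemma centralizing x : homogeneous false x -> fam 0 (red x) (e C 6) = 0 ->
  exists y, [/\ homogeneous false y, red y = red x & br y f6 = 0].
Proof.
move=> x0 red0; have [p [q E]] := decomp_odd (br_hom br_lie x0 f6_odd).
have q0 : q = 0.
  have := form_br6_5 br_lie B_form f1_even f6_odd r0 x.
  rewrite E (formDl B_form) !(formZl B_form) form55 form65 mulr0 add0r mulrN.
  by move=> /eqP; rewrite oppr_eq0 => /eqP/w_eq0.
rewrite q0 scale0r addr0 in E.
(* The coefficient of the correction vanishes modulo t, so subtracting it does not change the
   reduction. *)
have p0 : coef0 p = 0.
  have := red_br br_lie br_def x f6; rewrite red6 red0 E /red map_mxZ -/(red
    f5) red5.
  rewrite eE row6Z -row60 => /row6_inj[_ [_ + _]].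
  by rewrite mulr1.
exists (x - p *: f1); split.
- by apply: homogeneousD => //; apply/homogeneousN/homogeneousZ.
- by rewrite /red map_mxB map_mxZ [X in X *: _]p0 scale0r subr0.
by rewrite (brDl br_lie) (brNl br_lie) (brZl br_lie) E subrr.
Qed.

Lemma centralizer_br5 x : homogeneous false x -> br x f6 = 0 -> br x f5 = 0.
Proof.
move=> x0 x6.
have [B6 B5] := centralizer_form5 br_lie B_form f1_even f6_odd br15 r0 x6.
exact: odd_eq0 (br_hom br_lie x0 f5_odd) B5 B6.
Qed.

Section EvenFrame.
Variables f2 f3 : V.
Hypotheses (f2_even : homogeneous false f2) (f3_even : homogeneous false f3)
  (red2 : red f2 = e C 2) (red3 : red f3 = e C 3)
  (br26 : br f2 f6 = 0) (br36 : br f3 f6 = 0).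

Let br25 := centralizer_br5 f2_even br26.
Let br35 := centralizer_br5 f3_even br36.
Let br24 : br f2 f4 = 0 := centralizer_br4 br_lie f6_odd f2_even br26.
Let br34 : br f3 f4 = 0 := centralizer_br4 br_lie f6_odd f3_even br36.

(** Among the even frame vectors only [f1] pairs nontrivially with [f4], and it does so to the unit
    [w]; orthogonality to [f4] therefore removes the [f1] component. *)
Let even_comb z : homogeneous false z -> B z f4 = 0 ->
  exists p q t, z = p *: f2 + q *: f3 + t *: f4 /\
    red z = row6 0 (coef0 p) (coef0 q) (coef0 t) 0 0.
Proof.
move=> z0 Bz; have [a [p [q [t E]]]] := frame_decomp_even f1_even f2_even
  f3_even
  f4_even f5_odd f6_odd red1 red2 red3 red4 red5 red6 z0.
have a0 : a = 0.
  apply: w_eq0; move: Bz; rewrite E !(formDl B_form) !(formZl B_form).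
  rewrite (form14 f1 f6 B_form) -/w (form44 k3 br_lie B_form f6_odd).
  rewrite (centralizer_form4 B_form br26) (centralizer_form4 B_form br36).
  by rewrite !mulr0 !addr0.
exists p, q, t; split; first by rewrite E a0 scale0r add0r.
have := red_comb red1 red2 red3 red4 red5 red6 a p q t 0 0.
by rewrite !scale0r !addr0 -E a0 coef0_0.
Qed.

Lemma even_frame_equivalent : exists2 s', coef0 s' = 0 & equivalent br (fam s').
Proof.
have br_ee x y : homogeneous false x -> homogeneous false y -> homogeneous
  false (br x y).
  exact: br_hom.
have form_br x y : br y f4 = 0 -> B (br x y) f4 = 0.
  by move=> y4; rewrite (form_invariant B_form) y4 (form0r B_form).
have [p [q [t [br12 redE12]]]] := even_comb (br_ee _ _ f1_even f2_even)
  (form_br _ _ br24).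
have [q' [p' [t' [br13 redE13]]]] := even_comb (br_ee _ _ f1_even f3_even)
  (form_br _ _ br34).
have [al [be [ga [br23 redE23]]]] := even_comb (br_ee _ _ f2_even f3_even)
  (form_br _ _ br34).
have [p_1 q_0 t_0] : [/\ coef0 p = 1, coef0 q = 0 & coef0 t = 0].
  move: redE12; rewrite (red_br br_lie br_def) red1 red2 !eE fam_row6.
  move=> /row6_inj[[_ E1 E2] [E3 _ _]].
  by split; [rewrite -E1|rewrite -E2|rewrite -E3]; ring.
have [p'_1 q'_0 t'_0] : [/\ coef0 p' = -1, coef0 q' = 0 & coef0 t' = 0].
  move: redE13; rewrite (red_br br_lie br_def) red1 red3 !eE fam_row6.
  move=> /row6_inj[[_ E1 E2] [E3 _ _]].
  by split; [rewrite -E2|rewrite -E1|rewrite -E3]; ring.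
have ga_1 : coef0 ga = 1.
  move: redE23; rewrite (red_br br_lie br_def) red2 red3 !eE fam_row6.
  by move=> /row6_inj[_ [<- _ _]]; ring.
have [jac_al jac_be jac_ga] : [/\ al * p + be * q' = (p + p') * al,
    al * q + be * p' = (p + p') * be & al * t + be * t' = (p + p') * ga].
  have := jacobi_comb h2 br_lie f1_even f2_even f3_even f4_even br12 br13 br23
    br14E br24 br34.
  by move=> /(_ f5 f6)/(frame_comb_inj red1 red2 red3 red4 red5 red6)[[_ -> ->]
    [->]].
(* This determinant is -1 modulo t. *)
have [u uE] : exists u, (p * p' - q * q') * u = 1.
  apply: fps_unit; rewrite coef0D coef0N !coef0M p_1 p'_1 q_0 q'_0 mulr0 subr0
    mul1r.
  by rewrite oppr_eq0 oner_eq0.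
rewrite mulrC in uE.
have [al0 be0] := eigen_determinant uE jac_al jac_be.
have [gai gaE] : exists gai, ga * gai = 1 by apply: fps_unit; rewrite ga_1
  oner_eq0.
(* With [al] and [be] zero, the [f4] component of the Jacobi identity reads (p + p') ga = 0, and
   [ga] is a unit. *)
have p'E : p' = - p.
  apply/eqP; rewrite eq_sym -subr_eq0 -opprD oppr_eq0; apply/eqP.
  by rewrite -[LHS]mulr1 -gaE mulrA -jac_ga al0 be0 !mul0r addr0 mul0r.
have two0 : (2 : C) != 0 by rewrite pnatr_eq0.
have [|m mE m_1] := @fps_sqrt C (p ^+ 2 + q * q') two0.
  by rewrite coef0D expr2 !coef0M p_1 q_0 mul0r mulr1 addr0.
have [mi miE] : exists mi, m * mi = 1 by apply: fps_unit; rewrite m_1 oner_eq0.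
have mi_1 : coef0 mi = 1 by rewrite (coef0_inv miE) m_1 invr1.
(* The product is 2 modulo t, so [k] reduces to 1/2. Then the coefficient [k * (m + p)] of the new
   second vector reduces to 1, as needed for an equivalence. *)
have [k kE] : exists k, (m * (m + p) * ga) * k = 1.
  apply: fps_unit; rewrite !coef0M coef0D m_1 p_1 ga_1 mul1r mulr1.
  exact: two0.
have k_2 : coef0 k = 2^-1.
  by rewrite (coef0_inv kE) !coef0M coef0D m_1 p_1 ga_1 mul1r mulr1.
have {}kE : k * m * (m + p) * ga = 1 by rewrite -[RHS]kE [RHS]mulrC !mulrA.
exists (s * mi ^+ 2); first by rewrite coef0M s0 mul0r.
move: br13 br23; rewrite p'E al0 be0 scaleNr !scale0r !add0r => br13 br23.
have br45 : br f4 f5 = 0.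
  by apply: oppr_inj; rewrite -(skew_even br_lie f4_even f5_odd) br54E oppr0.
have br46 : br f4 f6 = 0.
  by apply: oppr_inj; rewrite -(skew_even br_lie f4_even f6_odd) br64E oppr0.
apply: frame_equivalent (normalized_frame_morphism h2 br_lie f1_even f2_even
  f3_even
  f4_even f5_odd f6_odd br12 br13 br23 br14E br24 br25 br26 br34 br35 br36 br45
  br46 br15 (erefl f5) br55E r0 (erefl f4) mE miE kE) => //.
- exact: homogeneousZ.
- exact: comb_even.
- exact: comb_even.
- exact: homogeneousZ.
- by rewrite /red map_mxZ -/(red f1) red1 [X in X *: _]mi_1 scale1r.
- have -> : red (k * (m + p) *: f2 + (k * q) *: f3 +
     (k * mi * ((m + p) * t + q * t')) *: f4) =
     row6 0 (coef0 (k * (m + p))) (coef0 (k * q))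
       (coef0 (k * mi * ((m + p) * t + q * t'))) 0 0.
    have := red_comb red1 red2 red3 red4 red5 red6 0 (k * (m + p)) (k * q)
      (k * mi * ((m + p) * t + q * t')) 0 0.
    by rewrite !scale0r !addr0 add0r coef0_0.
  rewrite !(coef0M, coef0D) k_2 m_1 p_1 q_0 t_0 mi_1 eE.
  by congr row6; rewrite ?mulVf // ?(mulr0, mul0r, addr0).
- set a := - (_ * q'); set b := _ * (m + p); set c := _ * (_ - _).
  have := red_comb red1 red2 red3 red4 red5 red6 0 a b c 0 0.
  rewrite !scale0r !addr0 add0r coef0_0 => ->.
  rewrite /a /b /c !(coef0M, coef0D, coef0N) m_1 p_1 q'_0 t_0 t'_0 coef0C eE.
  by congr row6; rewrite ?mulVf // ?(mulr0, mul0r, addr0, oppr0).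
by rewrite /red map_mxZ -/(red f5) red5 [X in X *: _]mi_1 scale1r.
Qed.

End EvenFrame.

Lemma family_equivalent : exists2 s', coef0 s' = 0 & equivalent br (fam s').
Proof.
have [|f2 [f2_even red2 br26]] := centralizing (e_even (isT : 0 < 2 < 5)%N).
  by rewrite red_e !eE fam_row6 -row60; congr row6; ring.
have [|f3 [f3_even red3 br36]] := centralizing (e_even (isT : 0 < 3 < 5)%N).
  by rewrite red_e !eE fam_row6 -row60; congr row6; ring.
by apply: (even_frame_equivalent f2_even f3_even) => //; rewrite ?red2 ?red3
  red_e.
Qed.

End Family.

Lemma metric_deformation_equivalent :
  exists2 s, coef0 s = 0 & equivalent br (fam s).
Proof.
by have [s br15 s0] := br15_ex; exact: family_equivalent br15 s0.
Qed.

End Classification.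

Lemma reparametrize_famX (C : comNzRingType) (s : fps C) :
  coef0 s = 0 -> reparametrize s (fam (fpsX C)) = fam s.
Proof.
move=> s0; have sX := fps_compX s0; rewrite -[in RHS]sX.
apply: base_change_fam; rewrite ?fps_compN ?sX //.
- exact: fps_comp0.
- exact: fps_comp1.
by rewrite fps_comp1.
Qed.

Theorem theorem3p3p1 (R : realType) :
  let C : numClosedFieldType := complex R in
  exists D : 'rV[fps C]_(4 + 2) -> 'rV[fps C]_(4 + 2) -> 'rV[fps C]_(4 + 2),
    [/\ metric_deformation (@g42_1 C) D,
        ~ trivial_deformation (@g42_1 C) D,
        (forall D' : 'rV[fps C]_(4 + 2) -> 'rV[fps C]_(4 + 2) ->
                     'rV[fps C]_(4 + 2),
           metric_deformation (@g42_1 C) D' ->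
           ~ trivial_deformation (@g42_1 C) D' ->
           exists s : fps C,
             parameter_change s /\ equivalent D' (reparametrize s D)) &
        smooth_deformation_to D (@g42_2 C) 0%R].
Proof.
move=> C; exists (fam (fpsX C)); split.
- split; first exact/fam_deformation/coef0X.
  exact: fam_is_metric.
- exact: famX_nontrivial.
- move=> D' [[_ D'_def _] [D'_lie [B B_form]]] D'_nontrivial.
  have [s s0 D's] := metric_deformation_equivalent D'_lie B_form D'_def.
  exists s; split; last by rewrite reparametrize_famX.
  (* For [s = 0] the normal form is the undeformed bracket, contrary to nontriviality. *)
  split=> // s_eq0; apply: D'_nontrivial.
  by rewrite /trivial_deformation base_change_g42_1 -s_eq0.
- exact: famX_smooth.
Qed.
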